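(* Let $G$ be a finitely generated left-orderable group. Then every left-order on $G$ is a regular left-order if and only if $G$ is a Tararin poly-$\mathbb{Z}$ group.
   Context: A left-order on $G$ is a total order invariant under left multiplication, with positive cone $P=\{g:1\prec g\}$. It is regular if there are a finite set $X$, a surjective monoid homomorphism $\pi\colon X^*\to G$ and a regular language $\mathcal{L}\subseteq X^*$ (accepted by a finite state automaton) with $\pi(\mathcal{L})=P$. A group $G$ is a Tararin group if it admits a unique subnormal series $G=G_0\unrhd G_1\unrhd\cdots\unrhd G_n=\{1\}$ such that all factors $G_i/G_{i+1}$ are torsion-free abelian of rank $1$ and no quotient $G_i/G_{i+2}$ is bi-orderable (admits a total order invariant under both left and right multiplication). A group is poly-$\mathbb{Z}$ if it has a finite subnormal series with all factors infinite cyclic. A Tararin poly-$\mathbb{Z}$ group is a Tararin group that is poly-$\mathbb{Z}$. *)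

(* Defs.v *)
(* Groups are (possibly infinite) groups in the sense of
   mathcomp's [monoid.v] hierarchy ([groupType]); subgroups are represented
   by Prop-valued predicates (membership need not be decidable). *)
From HB Require Import structures.
From mathcomp Require Import all_boot monoid.
From mathcomp Require Import all_order all_algebra.

Set Implicit Arguments.
Unset Strict Implicit.
Unset Printing Implicit Defensive.

Local Open Scope group_scope.

Section Defs.

Variable G : groupType.

Definition zexpg (x : G) (k : int) : G :=
  match k with
  | Posz n => x ^+ n
  | Negz n => (x ^+ n.+1)^-1
  end.

Definition is_subgroup (H : G -> Prop) : Prop :=
  H 1 /\ (forall x y, H x -> H y -> H (x * y)) /\ (forall x, H x -> H x^-1).

Definition normal_in (N H : G -> Prop) : Prop :=
  is_subgroup N /\ (forall x, N x -> H x) /\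
  (forall h n, H h -> N n -> N (h^-1 * n * h)).

Definition subnormal_series (n : nat) (S : nat -> G -> Prop) : Prop :=
  (forall x, S 0%N x) /\ (forall x, S n x <-> x = 1) /\
  (forall i, (i < n)%N -> normal_in (S i.+1) (S i)).

Definition factor_tf_abelian_rank1 (H N : G -> Prop) : Prop :=
  (forall x y, H x -> H y -> N (x^-1 * y^-1 * x * y)) /\
  (forall x n, H x -> (0 < n)%N -> N (x ^+ n) -> N x) /\
  (exists x, H x /\ ~ N x) /\
  (forall x y, H x -> H y ->
     exists a b : int, (a != 0 \/ b != 0)%R /\ N (zexpg x a * zexpg y b)).

Definition factor_infinite_cyclic (H N : G -> Prop) : Prop :=
  exists t, H t /\
    (forall h, H h -> exists k : int, N ((zexpg t k)^-1 * h)) /\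
    (forall k : int, N (zexpg t k) -> k = 0%R).

(* the quotient H/N is bi-orderable: a strict total order [lt] on the cosets
   xN (x in H), given as a relation on H depending only on cosets, which is
   invariant under left and right multiplication by elements of H.  (The
   trichotomy + right invariance forces N to be normal in H.) *)
Definition quotient_biorderable (H N : G -> Prop) : Prop :=
  exists lt : G -> G -> Prop,
    let eqN x y := N (x^-1 * y) in
    (forall x x' y y', H x -> H x' -> H y -> H y' -> eqN x x' -> eqN y y' ->
        lt x y -> lt x' y') /\
    (forall x y, H x -> H y -> eqN x y -> ~ lt x y) /\
    (forall x y z, H x -> H y -> H z -> lt x y -> lt y z -> lt x z) /\
    (forall x y, H x -> H y -> eqN x y \/ lt x y \/ lt y x) /\
    (forall g x y, H g -> H x -> H y -> lt x y -> lt (g * x) (g * y)) /\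
    (forall g x y, H g -> H x -> H y -> lt x y -> lt (x * g) (y * g)).

Definition tararin_series (n : nat) (S : nat -> G -> Prop) : Prop :=
  subnormal_series n S /\
  (forall i, (i < n)%N -> factor_tf_abelian_rank1 (S i) (S i.+1)) /\
  (forall i, (i.+2 <= n)%N -> ~ quotient_biorderable (S i) (S i.+2)).

Definition tararin_group : Prop :=
  exists n S, tararin_series n S /\
    forall m S', tararin_series m S' ->
      m = n /\ forall i, (i <= n)%N -> forall x, S' i x <-> S i x.

Definition poly_Z : Prop :=
  exists n S, subnormal_series n S /\
    forall i, (i < n)%N -> factor_infinite_cyclic (S i) (S i.+1).

Definition finitely_generated : Prop :=
  exists gens : seq G, forall g : G, exists w : seq (bool * G),
    all (fun p => p.2 \in gens) w /\
    g = foldr (fun p acc => (if p.1 then p.2 else p.2^-1) * acc) 1 w.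

Definition left_order (lt : G -> G -> Prop) : Prop :=
  (forall x, ~ lt x x) /\
  (forall x y z, lt x y -> lt y z -> lt x z) /\
  (forall x y, x <> y -> lt x y \/ lt y x) /\
  (forall g x y, lt x y -> lt (g * x) (g * y)).

Definition left_orderable : Prop := exists lt, left_order lt.

Definition positive_cone (lt : G -> G -> Prop) : G -> Prop := fun g => lt 1 g.

Definition word_eval (X : Type) (f : X -> G) (w : seq X) : G :=
  foldr (fun a acc => f a * acc) 1 w.

Definition dfa_accepts (X Q : Type) (q0 : Q) (delta : Q -> X -> Q)
  (F : Q -> bool) (w : seq X) : bool := F (foldl delta q0 w).

Definition regular_left_order (lt : G -> G -> Prop) : Prop :=
  exists (X : finType) (f : X -> G),
    (forall g, exists w, word_eval f w = g) /\
    exists (Q : finType) (q0 : Q) (delta : Q -> X -> Q) (F : Q -> bool),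
      forall g, positive_cone lt g <->
        exists w, dfa_accepts q0 delta F w /\ word_eval f w = g.

End Defs.

(* Main.v *)
(* If every left-order on H is regular, the following happens. Regular languages being countable,
   H has countably many left-orders. Hence a minimal closed conjugation-invariant set of orders
   has an isolated point, which is then fixed by a positive power of every element; such an
   almost bi-invariant order has a convex normal subgroup with Archimedean quotient, so by
   Hoelder's argument H maps onto Z. If H/K is infinite cyclic, then any order of K extends
   lexicographically to H, and regularity of the extension gives regularity on K by a Schreier
   rewriting of the automaton; so the argument repeats. An infinite chain would give
   uncountably many orders by sign changes, and a bi-orderable H/L of length two would be Z^2,
   which has uncountably many orders. So G has a poly-Z Tararin series; it is unique because the
   inverting actions force every torsion-free abelian quotient to kill the next term.

   Conversely the chosen positive generators t_i of the factors of a poly-Z Tararin series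
   satisfy t_i s > 1 for all s in the next term, by the inverting actions, so every left-order is
   lexicographic and its cone consists of the words whose first letter is some t_i, followed by
   t_i's and letters of higher index. *)
Require Import Defs.
From HB Require Import structures.
From mathcomp Require Import all_boot monoid.
From mathcomp Require Import all_order all_algebra.
From mathcomp Require Import boolp zify ring lra.

Set Implicit Arguments.
Unset Strict Implicit.
Unset Printing Implicit Defensive.

Import Order.TTheory GRing.Theory Num.Theory.
Local Open Scope group_scope.

(** * Subgroups, degree maps and cones *)

(** Countability of the orders on a kernel K would already follow by extending them
    lexicographically to H. The automaton is rewritten for another reason: the search for a quotient
    Z uses finite generation, which K need not inherit from H, whereas the letters of an automaton
    for a positive cone generate the group. So the property carried down the chain is regularity of
    every cone, which yields finite generation and countability at once. Every appeal to
    uncountability is an explicit diagonalisation: against an enumeration [E] containing all regular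
    cones, a cone is built that differs from each [E n]. Almost bi-invariance suffices for Hölder's
    argument because any element that is not negligible against a cofinal element has a power that
    both exceeds it and normalises the cone. Uniqueness has to be proved against an arbitrary
    Tararin series, whose factors are only known to have rank 1. Subgroups of poly-Z groups being
    finitely generated, these factors are infinite cyclic too, so degree maps to the integers exist
    for both series. *)

Ltac group_norm := rewrite ?gnorm; try done.

Section IntegerPowers.
Variable G : groupType.
Implicit Types (x y : G) (k l : int).

Lemma zexpg_succ x k : zexpg x (k + 1)%R = zexpg x k * x.
Proof.
case: k => [n|n]; first by rewrite -PoszD addn1 /= expgSr.
rewrite NegzE; case: n => [|n]; first by rewrite /= mulVg.
have -> : (- n.+2%:Z + 1 = - n.+1%:Z)%R by lia.
by rewrite -!NegzE /= [in RHS]expgS invgM mulgVK.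
Qed.

Lemma zexpg_pred x k : zexpg x (k - 1)%R = zexpg x k * x^-1.
Proof. by rewrite -{2}[k](subrK 1%R) zexpg_succ mulgK. Qed.

Lemma zexpgD x k l : zexpg x (k + l)%R = zexpg x k * zexpg x l.
Proof.
elim/int_ind: l => [|n IH|n IH]; first by rewrite addr0 mulg1.
  by rewrite -addn1 PoszD addrA !zexpg_succ IH mulgA.
have -> : (- n.+1%:Z = - n%:Z - 1)%R by lia.
by rewrite addrA !zexpg_pred IH mulgA.
Qed.

Lemma zexpgN x k : zexpg x (- k)%R = (zexpg x k)^-1.
Proof. by apply: (@mulIg _ (zexpg x k)); rewrite -zexpgD addNr mulVg. Qed.

Lemma zexpg1 x : zexpg x 1 = x. Proof. by []. Qed.

Lemma conj_zexpg x y k : y^-1 * zexpg x k * y = zexpg (y^-1 * x * y) k.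
Proof.
elim/int_ind: k => [|n IH|n IH]; first by rewrite /= mulg1 mulVg.
  by rewrite -addn1 PoszD !zexpg_succ -IH; group_norm.
have -> : (- n.+1%:Z = - n%:Z - 1)%R by lia.
by rewrite !zexpg_pred -IH; group_norm.
Qed.

End IntegerPowers.

Section Subgroups.
Variable G : groupType.
Implicit Types (x y : G) (H N P : G -> Prop).

Lemma subgroupT : is_subgroup (fun _ : G => True). Proof. by []. Qed.

Lemma subgroup1 H : is_subgroup H -> H 1. Proof. by case. Qed.
Lemma subgroupM H x y : is_subgroup H -> H x -> H y -> H (x * y).
Proof. by case=> _ [+ _]; apply. Qed.
Lemma subgroupV H x : is_subgroup H -> H x -> H x^-1.
Proof. by case=> _ [_]; apply. Qed.
Lemma subgroupX H x n : is_subgroup H -> H x -> H (x ^+ n).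
Proof.
move=> sH Hx; elim: n => [|n IH]; first exact: subgroup1.
by rewrite expgS; exact: subgroupM.
Qed.
Lemma subgroup_zexpg H x k : is_subgroup H -> H x -> H (zexpg x k).
Proof.
move=> sH Hx; case: k => n /=; first exact: subgroupX.
by apply: subgroupV => //; apply: (@subgroupX _ _ n.+1).
Qed.

Lemma subgroupVE H x : is_subgroup H -> H x^-1 <-> H x.
Proof. by move=> sH; split=> /(subgroupV sH)//; rewrite invgK. Qed.

Lemma subgroupMl H x y : is_subgroup H -> H x -> H (x * y) <-> H y.
Proof.
move=> sH Hx; split=> [|Hy]; last exact: subgroupM.
by move=> /(subgroupM sH (subgroupV sH Hx)); rewrite mulKg.
Qed.

Lemma normal_sub N H x : normal_in N H -> N x -> H x.
Proof. by case=> _ [+ _]; apply. Qed.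
Lemma normal_subgroup N H : normal_in N H -> is_subgroup N. Proof. by case. Qed.
Lemma normal_conj N H x y : normal_in N H -> H y -> N x -> N (y^-1 * x * y).
Proof. by case=> _ [_]; apply. Qed.
Lemma normal_conjV N H x y : is_subgroup H -> normal_in N H -> H y -> N x ->
  N (y * x * y^-1).
Proof. by move=> sH nN Hy Nx; rewrite -{1}[y]invgK; apply: (normal_conj nN) => //; apply: subgroupV. Qed.

Definition hom_on (A : zmodType) H (phi : G -> A) :=
  forall x y, H x -> H y -> phi (x * y) = (phi x + phi y)%R.

Section Hom.
Variables (A : zmodType) (H : G -> Prop) (phi : G -> A).
Hypotheses (sH : is_subgroup H) (hphi : hom_on H phi).

Lemma hom1 : phi 1 = 0%R.
Proof.
have := hphi (subgroup1 sH) (subgroup1 sH); rewrite mulg1 => /esym/eqP.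
by rewrite -subr_eq0 addrK => /eqP.
Qed.

Lemma homV x : H x -> phi x^-1 = (- phi x)%R.
Proof.
move=> Hx; apply/eqP; rewrite -addr_eq0 -hphi ?mulVg ?hom1 //; exact: subgroupV.
Qed.

Lemma homX x n : H x -> phi (x ^+ n) = (phi x *+ n)%R.
Proof.
move=> Hx; elim: n => [|n IH]; first by rewrite hom1.
by rewrite expgS mulrS hphi ?IH //; apply: subgroupX.
Qed.

Lemma hom_zexpg x k : H x -> phi (zexpg x k) = (phi x *~ k)%R.
Proof.
move=> Hx; case: k => n; first exact: homX.
by rewrite NegzE zexpgN homV ?homX ?mulrNz //; apply: subgroupX.
Qed.

Lemma hom_conj x y : H x -> H y -> phi (y^-1 * x * y) = phi x.
Proof.
move=> Hx Hy; have HV := subgroupV sH Hy.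
by rewrite (hphi (subgroupM sH HV Hx) Hy) (hphi HV Hx) homV // addrAC addNr add0r.
Qed.

End Hom.

(** An isomorphism of H/N with the integers, written as a total function on [G] with arbitrary
    values outside [H]. It replaces the quotient group and turns coset arguments into integer
    arithmetic. *)
Definition degree H N (psi : G -> int) :=
  [/\ hom_on H psi, forall x, H x -> (N x <-> psi x = 0%R) &
      exists2 t, H t & psi t = 1%R].

Lemma degree_cyclic H N psi :
  is_subgroup H -> degree H N psi -> factor_infinite_cyclic H N.
Proof.
move=> sH [hpsi kpsi [t Ht t1]]; exists t; split=> //; split=> [h Hh|k].
  exists (psi h); apply/kpsi; first by apply: subgroupM => //; apply: subgroupV => //; apply: subgroup_zexpg.
  rewrite hpsi ?(homV sH hpsi) ?(hom_zexpg sH hpsi) ?t1 //; last 2 first.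
  - exact: subgroup_zexpg.
  - by apply: subgroupV => //; apply: subgroup_zexpg.
  by rewrite intz addNr.
move/kpsi; rewrite (hom_zexpg sH hpsi) // t1 intz; apply; exact: subgroup_zexpg.
Qed.

Lemma cyclic_degree H N :
  is_subgroup H -> normal_in N H -> factor_infinite_cyclic H N ->
  exists psi, degree H N psi.
Proof.
move=> sH nN [t [Ht [ex uniq]]]; have sN := normal_subgroup nN.
have exk h : exists k, H h -> N ((zexpg t k)^-1 * h).
  by case: (EM (H h)) => [/ex[k Nk]|nH]; [exists k|exists 0%R].
have [psi psiP] := choice exk.
have psiE h k : H h -> N ((zexpg t k)^-1 * h) -> psi h = k.
  move=> Hh Nk; apply/eqP; rewrite -subr_eq0; apply/eqP/uniq.
  have := subgroupM sN Nk (subgroupV sN (psiP _ Hh)).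
  by rewrite invgM invgK mulgA mulgK -zexpgN -zexpgD addrC.
have Htk k : H (zexpg t k) by exact: subgroup_zexpg.
exists psi; split=> [x y Hx Hy|x Hx|].
- apply: psiE; first exact: subgroupM.
  have := subgroupM sN (normal_conj nN (Htk (psi y)) (psiP _ Hx)) (psiP _ Hy).
  by rewrite zexpgD; group_norm.
- split=> [Nx|x0]; first by apply: psiE => //; rewrite /= invg1 mul1g.
  by have := psiP _ Hx; rewrite x0 /= invg1 mul1g.
- by exists t => //; apply: psiE => //; rewrite zexpg1 mulVg; exact: subgroup1.
Qed.

Definition cone H P :=
  [/\ forall x, P x -> H x, ~ P 1, forall x y, P x -> P y -> P (x * y) &
      forall x, H x -> [\/ x = 1, P x | P x^-1]].

Lemma coneVF H P x : cone H P -> P x -> ~ P x^-1.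
Proof. by case=> _ P1 PM _ Px Px'; apply: P1; rewrite -(mulgV x); exact: PM. Qed.

Lemma lex_cone (T : realDomainType) H (phi : G -> T) Q :
  is_subgroup H -> hom_on H phi -> cone (fun x => H x /\ phi x = 0%R) Q ->
  cone H (fun x => H x /\ ((0 < phi x)%R \/ Q x)).
Proof.
move=> sH hphi [QH Q1 QM Qtot]; split=> [x []//||x y|x Hx].
- by case=> _ []; rewrite ?(hom1 sH hphi) ?ltxx.
- move=> [Hx Px] [Hy Py]; split; first exact: subgroupM.
  case: Px Py => [Px|Qx] [Py|Qy]; last by right; apply: QM.
  + by left; rewrite hphi // addr_gt0.
  + by left; rewrite hphi // (QH _ Qy).2 addr0.
  + by left; rewrite hphi // (QH _ Qx).2 add0r.
- have HV := subgroupV sH Hx.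
  case: (ltgtP 0%R (phi x)) => [xp|xn|x0].
  + by apply: Or32; split=> //; left.
  + by apply: Or33; split=> //; left; rewrite (homV sH hphi) // oppr_gt0.
  + case: (Qtot x) => // [->|Qx|Qx]; first exact: Or31.
      by apply: Or32; split=> //; right.
    by apply: Or33; split=> //; right.
Qed.

End Subgroups.

(** * Finite generation and infinite cyclic quotients *)

Section FinitelyGenerated.
Variable G : groupType.
Implicit Types (x y : G) (H N P : G -> Prop).

(** Generation is phrased as an induction principle over subgroups, so that closure arguments need
    no words. *)
Definition fg_subgroup H :=
  exists2 gens : seq G, forall x, x \in gens -> H x &
    forall K, is_subgroup K -> (forall x, x \in gens -> K x) ->
      forall h, H h -> K h.

(** The quotient becomes a genuine [zmodType], so that the library's integer multiples apply. Cosets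
    are predicates compared by extensionality, and chosen representatives carry the operations. *)
Lemma abelian_quotient H N :
  is_subgroup H -> normal_in N H ->
  (forall x y, H x -> H y -> N (x^-1 * y^-1 * x * y)) ->
  exists (A : zmodType) (pi : G -> A),
    hom_on H pi /\ forall x, H x -> (N x <-> pi x = 0%R).
Proof.
move=> sH nN ab; have sN := normal_subgroup nN.
pose coset x : G -> Prop := fun y => N (x^-1 * y).
have cosetE x y : coset x = coset y <-> N (x^-1 * y).
  split=> [e|Nxy]; first by rewrite -/(coset x y) e /coset mulVg; apply: subgroup1.
  apply/funext => z; apply/propext; split=> Nz.
    have := subgroupM sN (subgroupV sN Nxy) Nz.
    by rewrite invgM invgK mulgA mulgK.
  by have := subgroupM sN Nxy Nz; rewrite mulgA mulgK.
pose T0 := {S : G -> Prop | exists2 x, H x & S = coset x}.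
pose T : choiceType := HB.pack T0 (gen_eqMixin T0) (gen_choiceMixin T0).
have inT x : exists S : T, H x -> sval S = coset x.
  case: (EM (H x)) => [Hx|nHx].
    have e : exists2 y, H y & coset x = coset y by exists x.
    by exists (exist _ (coset x) e : T).
  have e : exists2 y, H y & coset 1 = coset y by exists 1 => //; apply: subgroup1.
  by exists (exist _ (coset 1) e : T).
have [mk mkE] := choice inT.
have mk_eq x y : H x -> H y -> N (x^-1 * y) -> mk x = mk y.
  move=> Hx Hy Nxy; have : sval (mk x) = sval (mk y).
    by rewrite !mkE //; apply/cosetE.
  case: (mk x) (mk y) => [S p] [S' p'] /= e; subst S'.
  by rewrite (Prop_irrelevance p p').
have ex_rep (a : T) : exists x, H x /\ a = mk x.
  case: a => S [x Hx SE]; exists x; split=> //.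
  have := mkE x Hx; case: (mk x) => S' p' /=.
  rewrite -SE => e; subst S'; congr exist; exact: Prop_irrelevance.
have [rep repP] := choice ex_rep.
have Hrep a : H (rep a) by case: (repP a).
have repK a : mk (rep a) = a by case: (repP a).
have mk_rep x : H x -> N (x^-1 * rep (mk x)).
  by move=> Hx; apply/cosetE; rewrite -(mkE x) // -(mkE (rep _)) ?repK.
pose add a b := mk (rep a * rep b).
have addE x y : H x -> H y -> add (mk x) (mk y) = mk (x * y).
  move=> Hx Hy; apply/esym/mk_eq; [exact: subgroupM|exact: subgroupM|].
  have -> : (x * y)^-1 * (rep (mk x) * rep (mk y)) =
     (y^-1 * (x^-1 * rep (mk x)) * y) * (y^-1 * rep (mk y)) by group_norm.
  apply: subgroupM => //; last exact: mk_rep.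
  by apply: (normal_conj nN) => //; exact: mk_rep.
have addA : associative add.
  move=> a b c; rewrite -(repK a) -(repK b) -(repK c).
  by rewrite !addE ?mulgA //; apply: subgroupM.
have addC : commutative add.
  move=> a b; rewrite -(repK a) -(repK b) !addE //; apply: mk_eq; try exact: subgroupM.
  have := ab _ _ (Hrep b) (Hrep a).
  by rewrite invgM; group_norm.
have add0 : left_id (mk 1) add.
  by move=> a; rewrite -(repK a) addE ?mul1g //; apply: subgroup1.
have addN : left_inverse (mk 1) (fun a => mk (rep a)^-1) add.
  by move=> a; rewrite -{2}(repK a) addE ?mulVg //; apply: subgroupV.
pose A : zmodType := HB.pack T (GRing.isZmodule.Build T addA addC add0 addN).
exists A, mk; split=> [x y Hx Hy|x Hx]; first by rewrite -addE.
split=> [Nx|e]; first by apply: mk_eq; rewrite ?mulg1; [|apply: subgroup1|apply: subgroupV].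
apply/(subgroupVE _ sN); rewrite -[x^-1]mulg1; apply/cosetE.
rewrite -!mkE //; last exact: subgroup1.
by congr sval.
Qed.

(** Generators are absorbed one at a time by a gcd computation: in a torsion-free abelian group two
    elements with a nontrivial relation lie in a common cyclic subgroup. *)
Lemma cyclic_of_rank1 H N :
  is_subgroup H -> normal_in N H -> fg_subgroup H ->
  factor_tf_abelian_rank1 H N -> factor_infinite_cyclic H N.
Proof.
move=> sH nN [gens gH genP] [ab [tf [[x0 [Hx0 nNx0]] rk1]]].
have [A [pi [hpi kpi]]] := abelian_quotient sH nN ab.
have piz x k : H x -> pi (zexpg x k) = (pi x *~ k)%R by apply: hom_zexpg.
have Hz x k : H x -> H (zexpg x k) by apply: subgroup_zexpg.
have tfA x k : H x -> k != 0%R -> (pi x *~ k)%R = 0%R -> pi x = 0%R.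
  move=> Hx k0 e; apply/kpi => //; apply: (tf x `|k|%N) => //.
    by rewrite absz_gt0.
  apply/kpi; first exact: subgroupX.
  rewrite (homX sH hpi) // pmulrn abszE; case: (ger0P k) => _ //.
  by rewrite mulrNz e oppr0.
have [c Hc cP] : exists2 c, H c & forall x, x \in gens -> exists k, pi x = (pi c *~ k)%R.
  elim: (gens) gH => [_|a l IH lH]; first by exists 1 => //; apply: subgroup1.
  have [|c Hc cP] := IH; first by move=> x xl; apply: lH; rewrite inE xl orbT.
  have Ha : H a by apply: lH; rewrite mem_head.
  have [p [q [pq /kpi]]] := rk1 _ _ Hc Ha.
  move=> /(_ (subgroupM sH (Hz _ _ Hc) (Hz _ _ Ha))); rewrite hpi ?piz; [|by auto..] => rel0.
  have g0 : gcdz p q != 0%R by rewrite gcdz_eq0; case: pq => /negPf ->; rewrite ?andbF.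
  have [u [v]] := Bezoutz p q.
  have /dvdzP[p' pE] := dvdz_gcdl p q; have /dvdzP[q' qE] := dvdz_gcdr p q.
  move: g0 pE qE; set g := gcdz p q => g0 pE qE.
  rewrite pE qE !mulrA -mulrDl -[RHS]mul1r => /(mulIf g0) bez.
  have rel : (pi c *~ p' + pi a *~ q' = 0)%R.
    rewrite -!piz // -hpi; [|by auto..]; apply: (tfA _ g) => //.
      by apply: subgroupM => //; exact: Hz.
    by rewrite hpi ?piz; [|by auto..]; rewrite mulrzDl -!mulrzA -pE -qE.
  have relq : (pi a *~ q' = - (pi c *~ p'))%R.
    by apply/eqP; rewrite -addr_eq0 addrC rel.
  (* From p' c + q' a = 0 and u p' + v q' = 1, the element e = v c - u a satisfies c = q' e and a =
     - p' e. *)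
  pose e := zexpg c v * zexpg a (- u)%R; exists e; first by apply: subgroupM => //; exact: Hz.
  have eE : pi e = (pi c *~ v - pi a *~ u)%R.
    by rewrite hpi ?piz; [|by auto..]; rewrite mulrNz.
  have ec : pi c = (pi e *~ q')%R.
    rewrite eE mulrzBl -!mulrzA [(u * q')%R]mulrC [(pi a *~ (_ * _))%R]mulrzA relq mulNrz opprK.
    by rewrite -mulrzA -mulrzDr addrC [(p' * u)%R]mulrC bez mulr1z.
  have ea : pi a = (pi e *~ (- p'))%R.
    rewrite eE mulrzBl !mulrNz opprK -!mulrzA [(v * p')%R]mulrC.
    rewrite [(pi c *~ (_ * _))%R]mulrzA -mulNrz -relq -mulrzA -mulrzDr.
    by rewrite addrC [(q' * v)%R]mulrC bez mulr1z.
  move=> x; rewrite inE => /orP[/eqP->|/cP[k xk]]; first by exists (- p')%R.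
  by exists (q' * k)%R; rewrite xk {1}ec mulrzA.
have cgen h : H h -> exists k, pi h = (pi c *~ k)%R.
  move=> Hh; suff: H h /\ exists k, pi h = (pi c *~ k)%R by case.
  apply: (genP (fun h => H h /\ exists k, pi h = (pi c *~ k)%R)) => //.
    split; first by split; [exact: subgroup1|exists 0%R; rewrite (hom1 sH hpi)].
    split=> [x y [Hx [k xk]] [Hy [l yl]]|x [Hx [k xk]]].
      by split; [exact: subgroupM|exists (k + l)%R; rewrite hpi // xk yl mulrzDr].
    by split; [exact: subgroupV|exists (- k)%R; rewrite (homV sH hpi) // xk mulrNz].
  by move=> x xg; split; [exact: gH|exact: cP].
have c0 : pi c <> 0%R.
  by move=> c0; apply: nNx0; apply/kpi => //; have [k ->] := cgen _ Hx0; rewrite c0 mul0rz.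
exists c; split=> //; split=> [h Hh|k].
  have [k hk] := cgen _ Hh; exists k; apply/kpi.
    by apply: subgroupM => //; apply: subgroupV => //; apply: Hz.
  rewrite hpi ?(homV sH hpi) ?piz ?hk ?addNr //; try exact: Hz.
  by apply: subgroupV => //; apply: Hz.
move/kpi => /(_ (Hz _ _ Hc)); rewrite piz // => ck.
by apply/eqP/negP => /negP k0; apply: c0; apply: (tfA _ k).
Qed.

Lemma rank1_of_degree H N psi :
  is_subgroup H -> normal_in N H -> degree H N psi -> factor_tf_abelian_rank1 H N.
Proof.
move=> sH nN [hpsi kpsi [t Ht t1]].
have HV x : H x -> H x^-1 by apply: subgroupV.
have HM x y : H x -> H y -> H (x * y) by apply: subgroupM.
have Hz x k : H x -> H (zexpg x k) by apply: subgroup_zexpg.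
split; [|split; [|split]].
- move=> x y Hx Hy; apply/kpsi; first by auto 8.
  rewrite !hpsi ?(homV sH hpsi) //; auto; lia.
- move=> x n Hx n0 /kpsi; rewrite (homX sH hpsi) // => /(_ (subgroupX n sH Hx)) /eqP.
  rewrite -mulr_natr mulf_eq0 => /orP[/eqP?|]; first exact/kpsi.
  by rewrite pnatr_eq0; case: n n0.
- by exists t; split=> // /kpsi - /(_ Ht); rewrite t1.
- move=> x y Hx Hy.
  case: (eqVneq (psi y) 0%R) => [y0|yn0].
    exists 0%R, 1%R; split; [by right|apply/kpsi; first by apply: HM; auto].
    by rewrite hpsi ?(hom_zexpg sH hpsi) ?y0 ?mulr0z ?mul0rz //; auto.
  exists (psi y), (- psi x)%R; split; [by left|apply/kpsi; first by apply: HM; auto].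
  rewrite hpsi ?(hom_zexpg sH hpsi) //; auto.
  by rewrite mulrNz !mulrzz mulrC subrr.
Qed.

(** Isolators of the spans of longer and longer lists of generators eventually fill [H]. Where this
    first happens, the quotient by the previous isolator is torsion-free of rank 1, hence cyclic. *)
Lemma cyclic_quotient_of_fg_abelian H N :
  is_subgroup H -> normal_in N H -> fg_subgroup H ->
  (forall x y, H x -> H y -> N (x^-1 * y^-1 * x * y)) ->
  (forall x n, H x -> (0 < n)%N -> N (x ^+ n) -> N x) ->
  (exists2 x, H x & ~ N x) ->
  exists2 K, normal_in K H & factor_infinite_cyclic H K.
Proof.
move=> sH nN fgH ab tf [x0 Hx0 nNx0]; have [gens gH genP] := fgH.
have [A [pi [hpi kpi]]] := abelian_quotient sH nN ab.
have HV x : H x -> H x^-1 by apply: subgroupV.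
have HM x y : H x -> H y -> H (x * y) by apply: subgroupM.
have Hz x k : H x -> H (zexpg x k) by apply: subgroup_zexpg.
pose D := fix D (l : seq G) (a : A) : Prop :=
  if l is y :: l' then exists k, D l' (a - pi y *~ k)%R else a = 0%R.
have D0 l : D l 0%R by elim: l => //= y l IH; exists 0%R; rewrite subr0.
have DB l a b : D l a -> D l b -> D l (a - b)%R.
  elim: l a b => [|y l IH] /= a b; first by move=> -> ->; rewrite subr0.
  move=> [k Dk] [m Dm]; exists (k - m)%R.
  suff -> : (a - b - pi y *~ (k - m) = (a - pi y *~ k) - (b - pi y *~ m))%R by apply: IH.
  by rewrite mulrzBr !opprD !opprK addrACA.
have DN l a : D l a -> D l (- a)%R by move=> Da; rewrite -[(- a)%R]sub0r; apply: DB.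
have DD l a b : D l a -> D l b -> D l (a + b)%R.
  by move=> Da Db; rewrite -[b]opprK; apply: DB => //; apply: DN.
have Dn l a n : D l a -> D l (a *+ n)%R.
  by move=> Da; elim: n => [|n IH]; rewrite ?mulr0n // mulrS; apply: DD.
(* The isolator of the span [D l] of the images of [l]: taking elements with a positive multiple in
   the span makes the quotient torsion-free. *)
pose I l x := H x /\ exists2 n, (0 < n)%N & D l (pi x *+ n)%R.
have sI l : is_subgroup (I l).
  split; first by split; [exact: subgroup1|exists 1%N; rewrite // (hom1 sH hpi)].
  split=> [x y [Hx [n n0 Dx]] [Hy [m m0 Dy]]|x [Hx [n n0 Dx]]].
    split; first exact: HM.
    exists (n * m)%N; first by rewrite muln_gt0 n0.
    rewrite hpi // mulrnDl mulrnA [(n * m)%N]mulnC [(pi y *+ _)%R]mulrnA.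
    by apply: DD; apply: Dn.
  split; first exact: HV.
  by exists n => //; rewrite (homV sH hpi) // mulNrn; apply: DN.
have nI l : normal_in (I l) H.
  split=> //; split=> [x []//|h n Hh [Hn Dn']].
  split; first by auto 8.
  by rewrite (hom_conj sH hpi).
have abI l x y : H x -> H y -> I l (x^-1 * y^-1 * x * y).
  move=> Hx Hy; split; first by auto 8.
  exists 1%N => //; suff -> : pi (x^-1 * y^-1 * x * y) = 0%R by rewrite mul0rn; apply: D0.
  by apply/kpi; [auto 8|exact: ab].
have tfI l x n : H x -> (0 < n)%N -> I l (x ^+ n) -> I l x.
  move=> Hx n0 [_ [m m0]]; rewrite (homX sH hpi) // -mulrnA => Dx.
  by split=> //; exists (n * m)%N => //; rewrite muln_gt0 n0.
apply: contrapT => noK.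
have big l : (forall x, x \in l -> H x) -> exists2 x, H x & ~ I l x.
  elim: l => [_|y l IH lH].
    exists x0 => // -[_ [n n0 /= e]]; apply: nNx0; apply: (tf _ n) => //.
    by apply/kpi; [exact: subgroupX|rewrite (homX sH hpi)].
  have [|x Hx nIx] := IH; first by move=> x xl; apply: lH; rewrite inE xl orbT.
  have Hy : H y by apply: lH; rewrite mem_head.
  apply: contrapT => full; apply: noK; exists (I l) => //.
  apply: cyclic_of_rank1 => //; split; [exact: abI|split; [exact: tfI|split; first by exists x]].
  have fullI z : H z -> I (y :: l) z by move=> Hz'; apply: contrapT => ?; apply: full; exists z.
  move=> a b Ha Hb; have [_ [n n0 /= [p Dp]]] := fullI _ Ha.
  have [_ [m m0 /= [q Dq]]] := fullI _ Hb.
  case: (eqVneq p 0%R) => [p0|pn0].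
    exists n, 0%R; split; first by left; rewrite -lt0n.
    have : I l (zexpg a n * zexpg b 0%R) by split; [auto 8|exists 1%N => //; rewrite mulg1 (homX sH hpi) //; move: Dp; rewrite p0 mulr0z subr0].
    by [].
  (* These coefficients eliminate y between n a = p y and m b = q y, both read modulo the span of
     [l]. *)
  exists (- (n%:Z * q))%R, (m%:Z * p)%R; split; first by right; rewrite mulf_neq0 //; lia.
  split; first by auto 8.
  exists 1%N => //; rewrite mulr1n hpi ?(hom_zexpg sH hpi); auto.
  have -> : (pi a *~ (- (n%:Z * q)) + pi b *~ (m%:Z * p) =
      (pi b *+ m - pi y *~ q) *~ p - (pi a *+ n - pi y *~ p) *~ q)%R.
    rewrite mulrNz [in LHS]addrC [(pi b *+ m)%R]pmulrn [(pi a *+ n)%R]pmulrn !mulrzBl.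
    by rewrite -!mulrzA [(q * p)%R]mulrC opprB addrA subrK.
  have Dz d k : D l d -> D l (d *~ k)%R.
    by move=> Dd; case: k => k; rewrite ?NegzE ?mulrNz; [|apply: DN]; apply: Dn.
  by apply: DB; apply: Dz.
have [x Hx []] := big gens gH; apply: (genP (I gens)) => // y yg; split; first exact: gH.
exists 1%N => //; rewrite mulr1n; elim: (gens) yg => //= z l IH; rewrite inE.
case/orP => [/eqP->|/IH Dy]; first by exists 1%R; rewrite mulr1z subrr.
by exists 0%R; rewrite mulr0z subr0.
Qed.

Lemma hom_int_image_cyclic H (psi : G -> int) :
  is_subgroup H -> hom_on H psi ->
  exists2 h0, H h0 & forall h, H h -> exists k, psi h = (psi h0 * k)%R.
Proof.
move=> sH hpsi; case: (EM (exists2 h, H h & psi h != 0%R)) => [[h1 Hh1 h1n]|no]; last first.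
  exists 1; first exact: subgroup1.
  move=> h Hh; exists 0%R; rewrite mulr0; apply/eqP/negP => /negP hn.
  by apply: no; exists h.
pose p n := `[< exists2 h, H h & psi h = Posz n.+1 >].
have ep : exists n, p n.
  exists `|psi h1|.-1; apply/asboolP; rewrite prednK ?absz_gt0 //.
  case: (ger0P (psi h1)) => h; first by exists h1; rewrite // gez0_abs.
  exists h1^-1; first exact: subgroupV.
  by rewrite (homV sH hpsi) //; lia.
case: (ex_minnP ep) => n /asboolP[h0 Hh0 e0] nmin; exists h0 => // h Hh.
exists (psi h %/ n.+1)%Z; rewrite e0.
have d0 : (n.+1%:Z != 0)%R by [].
have H1 : H (h * zexpg h0 (- (psi h %/ n.+1)%Z)%R).
  by apply: subgroupM => //; exact: subgroup_zexpg.
have e1 : psi (h * zexpg h0 (- (psi h %/ n.+1)%Z)%R) = (psi h %% n.+1)%Z.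
  rewrite hpsi ?(hom_zexpg sH hpsi) //; last exact: subgroup_zexpg.
  by rewrite e0 {1}(divz_eq (psi h) n.+1) mulrzz mulrN [(n.+1%:Z * _)%R]mulrC addrAC subrr add0r.
have r0 := modz_ge0 (psi h) d0; have rn := ltz_pmod (psi h) (isT : (0 < Posz n.+1)%R).
suff : (psi h %% n.+1)%Z = 0%R by move=> e; rewrite {1}(divz_eq (psi h) n.+1) e addr0 mulrC.
case Er : (psi h %% n.+1)%Z r0 rn e1 => [[|r]|r] // _ rn e1.
have /nmin : p r by apply/asboolP; exists (h * zexpg h0 (- (psi h %/ n.+1)%Z)%R).
by lia.
Qed.

(** Climb the series from the bottom, intersecting its terms with [H]: the degrees occurring in H ∩
    M form a cyclic group of integers, and an element of generating degree completes the generators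
    of H ∩ N. *)
Lemma poly_Z_fg_subgroup H : poly_Z G -> is_subgroup H -> fg_subgroup H.
Proof.
move=> [n [S [[S0 [Sn nS]] cyc]]] sH.
have sS i : (i <= n)%N -> is_subgroup (S i).
  case: i => [|i] lt; last exact: normal_subgroup (nS i lt).
  by split=> //; split.
suff fgi i : (i <= n)%N -> fg_subgroup (fun x => H x /\ S (n - i)%N x).
  have [gens gH genP] := fgi n (leqnn n).
  exists gens => [x /gH[]//|K sK gK h Hh]; apply: (genP K) => //.
  by rewrite subnn.
elim: i => [_|i IH lt].
  exists [::] => // K sK _ h [_]; rewrite subn0 => /Sn ->; exact: subgroup1.
have [gens gH genP] := IH (ltnW lt).
have ni : (n - i.+1 < n)%N by lia.
have eS : (n - i.+1).+1 = (n - i)%N by lia.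
have := cyclic_degree (sS _ (ltnW ni)) (nS _ ni) (cyc _ ni); rewrite eS.
have := sS _ (ltnW ni); have := nS _ ni; rewrite eS.
move: (S (n - i.+1)%N) (S (n - i)%N) gH genP => M N gH genP nN sM [psi [hpsi kpsi _]].
have sHM : is_subgroup (fun x => H x /\ M x).
  split; first by split; apply: subgroup1.
  by split=> [x y [? ?] [? ?]|x [? ?]]; split; (apply: subgroupM || apply: subgroupV).
have [h0 [Hh0 Mh0] h0P] : exists2 h0, H h0 /\ M h0 & forall h, H h /\ M h ->
    exists k, psi h = (psi h0 * k)%R.
  by apply: hom_int_image_cyclic => // x y [_ Mx] [_ My]; exact: hpsi.
exists (h0 :: gens) => [x|K sK gK h [Hh Mh]].
  by rewrite inE => /orP[/eqP->//|/gH[? Nx]]; split=> //; apply: (normal_sub nN).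
have Kh0 : K h0 by apply: gK; rewrite mem_head.
have [k hk] := h0P h (conj Hh Mh).
have Mz : M ((zexpg h0 k)^-1) by apply: subgroupV => //; exact: subgroup_zexpg.
have : K ((zexpg h0 k)^-1 * h).
  apply: genP => //; first by move=> x xg; apply: gK; rewrite inE xg orbT.
  split; first by apply: subgroupM => //; apply: subgroupV => //; exact: subgroup_zexpg.
  apply/kpsi; first exact: subgroupM.
  rewrite hpsi // (homV sM hpsi) ?(hom_zexpg sM hpsi) //; last exact: subgroup_zexpg.
  by rewrite hk mulrzz addNr.
by move/(subgroupMl _ sK); apply; apply: subgroupV => //; exact: subgroup_zexpg.
Qed.

End FinitelyGenerated.

(** * Tararin series *)

Section BiorderableQuotients.
Variables (G : groupType) (H M N : G -> Prop).
Hypotheses (sH : is_subgroup H) (nMH : normal_in M H) (nNM : normal_in N M).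
Variables (phi psi : G -> int).
Hypotheses (dphi : degree H M phi) (dpsi : degree M N psi).

Let sM := normal_subgroup nMH.
Let sN := normal_subgroup nNM.
Let MH x : M x -> H x := normal_sub nMH.
Let NM x : N x -> M x := normal_sub nNM.

(** Conjugation induces an automorphism of M/N = Z. It multiplies degrees by a constant, and the
    constants of g and of its inverse have product 1. *)
Lemma conj_degree_sign g :
  normal_in N H -> H g -> exists2 e : int, e = 1%R \/ e = (-1)%R &
    forall m, M m -> psi (g^-1 * m * g) = (e * psi m)%R.
Proof.
move=> nNH Hg; have [hpsi kpsi [u Mu u1]] := dpsi.
have conjE h : H h -> forall m, M m ->
    psi (h^-1 * m * h) = (psi (h^-1 * u * h) * psi m)%R.
  move=> Hh m Mm; pose r := (zexpg u (psi m))^-1 * m.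
  have Mz : M (zexpg u (psi m)) by exact: subgroup_zexpg.
  have Mr : M r by apply: subgroupM => //; apply: subgroupV.
  have Nr : N r.
    apply/kpsi => //; rewrite hpsi //; last exact: subgroupV.
    by rewrite (homV sM hpsi) // (hom_zexpg sM hpsi) // u1 intz addNr.
  have Mu' : M (h^-1 * u * h) by exact: normal_conj nMH Hh Mu.
  have -> : h^-1 * m * h = zexpg (h^-1 * u * h) (psi m) * (h^-1 * r * h).
    by rewrite -conj_zexpg /r; group_norm.
  rewrite hpsi //; [|exact: subgroup_zexpg|exact: normal_conj nMH Hh Mr].
  have /kpsi -> : N (h^-1 * r * h) by exact: normal_conj nNH Hh Nr.
    by rewrite (hom_zexpg sM hpsi) // mulrzz addr0.
  exact: normal_conj nMH Hh Mr.
exists (psi (g^-1 * u * g)); last exact: conjE.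
have := conjE _ (subgroupV sH Hg) _ (normal_conj nMH Hg Mu).
have -> : g^-1^-1 * (g^-1 * u * g) * g^-1 = u by group_norm.
rewrite u1; set a := psi _; set b := psi _ => ab.
have /eqP : (`|a| * `|b| = 1)%N by rewrite -abszM -ab.
by rewrite muln_eq1 => /andP[_ /eqP]; lia.
Qed.

(** Order lexicographically by [phi], then [psi]. Conjugation never changes [phi], as the integers
    are abelian, so only [psi] could obstruct right invariance. *)
Lemma biorderable_of_preserving :
  normal_in N H -> (forall g m, H g -> M m -> psi (g^-1 * m * g) = psi m) ->
  quotient_biorderable H N.
Proof.
move=> nNH pres; have [hpsi kpsi _] := dpsi; have [hphi kphi _] := dphi.
pose P h := (0 < phi h)%R \/ M h /\ (0 < psi h)%R.
have HV x : H x -> H x^-1 by apply: subgroupV.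
have HM x y : H x -> H y -> H (x * y) by apply: subgroupM.
have phi0 m : M m -> phi m = 0%R by move=> Mm; apply/kphi => //; exact: MH.
have psi0 m : N m -> psi m = 0%R by move=> Nm; apply/kpsi => //; exact: NM.
have PM x y : H x -> H y -> P x -> P y -> P (x * y).
  move=> Hx Hy [px|[Mx px]] [py|[My py]].
  - by left; rewrite hphi // addr_gt0.
  - by left; rewrite hphi // (phi0 y) // addr0.
  - by left; rewrite hphi // (phi0 x) // add0r.
  - by right; split; [exact: subgroupM|rewrite hpsi // addr_gt0].
have PNr x n : H x -> N n -> P x -> P (x * n).
  move=> Hx Nn [px|[Mx px]].
    by left; rewrite hphi //; [rewrite (phi0 n) ?addr0|]; auto.
  right; split; first by apply: subgroupM => //; auto.
  by rewrite hpsi //; [rewrite (psi0 n) ?addr0|]; auto.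
have PJ g x : H g -> H x -> P x -> P (g^-1 * x * g).
  move=> Hg Hx [px|[Mx px]]; first by left; rewrite (hom_conj sH hphi).
  by right; split; [exact: normal_conj nMH Hg Mx|rewrite pres].
have PNl x n : H x -> N n -> P x -> P (n * x).
  move=> Hx Nn Px; have -> : n * x = x * (x^-1 * n * x) by group_norm.
  by apply: PNr => //; exact: normal_conj nNH Hx Nn.
have NP x : H x -> N x -> ~ P x.
  by move=> Hx Nx [|[_]]; rewrite ?psi0 ?phi0 ?ltxx //; auto.
exists (fun x y => P (x^-1 * y)); split; [|split; [|split; [|split; [|split]]]].
- move=> x x' y y' Hx Hx' Hy Hy' Nx Ny Pxy.
  have -> : x'^-1 * y' = (x^-1 * x')^-1 * ((x^-1 * y) * (y^-1 * y')) by group_norm.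
  apply: PNl; [by auto 8|exact: subgroupV|].
  by apply: PNr; auto.
- by move=> x y Hx Hy Nxy; apply: NP; auto.
- move=> x y z Hx Hy Hz Pxy Pyz.
  have -> : x^-1 * z = (x^-1 * y) * (y^-1 * z) by group_norm.
  by apply: PM; auto.
- move=> x y Hx Hy; have Hxy : H (x^-1 * y) by auto.
  have -> : y^-1 * x = (x^-1 * y)^-1 by group_norm.
  move: (x^-1 * y) Hxy => h Hh.
  case: (ltgtP (phi h) 0%R) => [p|p|p].
  + by right; right; left; rewrite (homV sH hphi) // oppr_gt0.
  + by right; left; left.
  have Mh : M h by exact/kphi.
  case: (ltgtP (psi h) 0%R) => [q|q|q].
  + by right; right; right; split; [exact: subgroupV|rewrite (homV sM hpsi) // oppr_gt0].
  + by right; left; right.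
  by left; apply/kpsi.
- by move=> g x y Hg Hx Hy; rewrite invgM !mulgA mulgVK.
- move=> g x y Hg Hx Hy Pxy.
  have -> : (x * g)^-1 * (y * g) = g^-1 * (x^-1 * y) * g by group_norm.
  by apply: PJ; auto.
Qed.

(** Conjugation preserves the order on cosets. Hence it fixes the trivial coset, which makes [N]
    normal, and it cannot send [u] to its inverse, which lies on the other side of 1. *)
Lemma preserving_of_biorderable :
  quotient_biorderable H N ->
  normal_in N H /\ forall g m, H g -> M m -> psi (g^-1 * m * g) = psi m.
Proof.
case=> lt [ltN [ltF [ltT [tot [ltl ltr]]]]]; have [hpsi kpsi [u Mu u1]] := dpsi.
have HV x : H x -> H x^-1 by apply: subgroupV.
have HM x y : H x -> H y -> H (x * y) by apply: subgroupM.
have H1 : H 1 by exact: subgroup1.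
have conj_lt g x y : H g -> H x -> H y -> lt x y -> lt (g^-1 * x * g) (g^-1 * y * g).
  by move=> Hg Hx Hy xy; apply: ltr; auto; apply: ltl; auto.
have nNH : normal_in N H.
  split=> //; split=> [x /NM/MH//|h n Hh Nn].
  have Hn : H n by apply/MH/NM.
  have Hc : H (h^-1 * n * h) by auto.
  have Hh' := HV _ Hh.
  have eh x : h^-1^-1 * (h^-1 * x * h) * h^-1 = x by group_norm.
  have e1 : h^-1^-1 * 1 * h^-1 = 1 by group_norm.
  case: (tot 1 (h^-1 * n * h)) => // [|[c|c]]; first by rewrite invg1 mul1g.
    have := conj_lt _ _ _ Hh' H1 Hc c; rewrite eh e1 => /ltF; case=> //.
    by rewrite invg1 mul1g.
  have := conj_lt _ _ _ Hh' Hc H1 c; rewrite eh e1 => /ltF; case=> //.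
  by rewrite mulg1; apply: subgroupV.
split=> // g m Hg Mm; have [e [->|e1] eP] := conj_degree_sign nNH Hg; rewrite eP //.
  by rewrite mul1r.
exfalso; have Hu := MH Mu; have Hu' : H (g^-1 * u * g) by auto.
have Muc := normal_conj nMH Hg Mu.
have Ne : N (u^-1^-1 * (g^-1 * u * g)).
  rewrite invgK; apply/kpsi; first exact: subgroupM.
  by rewrite hpsi // eP // u1 e1; lia.
have Ne' : N ((g^-1 * u * g)^-1 * u^-1).
  by rewrite -[X in N X]invgK; apply: subgroupV => //; move: Ne; group_norm.
have N0 x : N (x^-1 * x) by rewrite mulVg; apply: subgroup1.
have cg1 : g^-1 * 1 * g = 1 by group_norm.
case: (tot 1 u) => // [|[c|c]].
- by rewrite invg1 mul1g => /kpsi - /(_ Mu); rewrite u1.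
- have := conj_lt _ _ _ Hg H1 Hu c; rewrite cg1 => c1.
  have c2 : lt 1 u^-1 by apply: (ltN 1 1 (g^-1 * u * g)) => //; auto.
  have := ltl u _ _ Hu H1 (HV _ Hu) c2; rewrite mulg1 mulgV => c3.
  by apply: (ltF 1 1) (ltT 1 u 1 H1 Hu H1 c c3).
- have := conj_lt _ _ _ Hg Hu H1 c; rewrite cg1 => c1.
  have c2 : lt u^-1 1 by apply: (ltN (g^-1 * u * g) _ 1 1) => //; auto.
  have := ltl u _ _ Hu (HV _ Hu) H1 c2; rewrite mulg1 mulgV => c3.
  by apply: (ltF 1 1) (ltT 1 u 1 H1 Hu H1 c3 c).
Qed.

End BiorderableQuotients.

(** * Uniqueness of Tararin series with infinite cyclic factors *)

Section TararinSeries.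
Variables (G : groupType) (n : nat) (S : nat -> G -> Prop).
Hypothesis ser : subnormal_series n S.

Lemma series_subgroup i : (i <= n)%N -> is_subgroup (S i).
Proof.
have [S0 [_ nS]] := ser; case: i => [|i] lt; last exact: normal_subgroup (nS i lt).
by split=> //; split.
Qed.

Lemma series_normal i : (i < n)%N -> normal_in (S i.+1) (S i).
Proof. by have [_ [_]] := ser; apply. Qed.

Lemma series_sub i j x : (i <= j)%N -> (j <= n)%N -> S j x -> S i x.
Proof.
elim: j => [|j IH]; first by rewrite leqn0 => /eqP->.
rewrite leq_eqVlt => /orP[/eqP->//|ij] jn Sx; apply: IH => //; first exact: ltnW.
exact: normal_sub (series_normal jn) Sx.
Qed.

Hypothesis deg : forall i, (i < n)%N -> exists psi, degree (S i) (S i.+1) psi.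
Hypothesis nbi : forall i, (i.+2 <= n)%N -> ~ quotient_biorderable (S i) (S i.+2).

(** As S (i+1) is itself such a K, this makes it the least kernel of a torsion-free abelian quotient
    of S i: an intrinsic description, from which uniqueness follows. *)
Definition killed_by_tf_abelian i := forall K, normal_in K (S i) ->
  (forall x y, S i x -> S i y -> K (x^-1 * y^-1 * x * y)) ->
  (forall x m, S i x -> (0 < m)%N -> K (x ^+ m) -> K x) ->
  forall x, S i.+1 x -> K x.

(** A conjugate of S (i+2) by an element h of S i is again the kernel of a torsion-free abelian
    quotient of S (i+1), so the hypothesis puts S (i+2) inside it. *)
Lemma normal_two_steps i : (i.+2 <= n)%N -> killed_by_tf_abelian i.+1 ->
  normal_in (S i.+2) (S i).
Proof.
move=> lt claim; have lt' := ltnW lt.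
have sS := series_subgroup (ltnW lt'); have sS1 := series_subgroup lt'.
have sS2 := series_subgroup lt.
have nS := series_normal lt'; have nS1 := series_normal lt.
split=> //; split=> [x|h x Sh Sx]; first by apply: series_sub => //; lia.
pose K y := S i.+1 y /\ S i.+2 (h^-1 * y * h).
suff [] : K x by [].
have [psi dpsi] := deg lt.
have [ab [tf _]] := rank1_of_degree sS1 nS1 dpsi.
have J y : S i.+1 y -> S i.+1 (h^-1 * y * h) by exact: (normal_conj nS).
have KE y z : h^-1 * (y * z) * h = (h^-1 * y * h) * (h^-1 * z * h) by group_norm.
have KV y : h^-1 * y^-1 * h = (h^-1 * y * h)^-1 by group_norm.
have sK : is_subgroup K.
  split; first by split; [exact: subgroup1|rewrite mulg1 mulVg; exact: subgroup1].
  split=> [y z [Sy Ky] [Sz Kz]|y [Sy Ky]]; rewrite /K ?KE ?KV.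
    by split; apply: subgroupM.
  by split; apply: subgroupV.
apply: claim => //.
- split=> //; split=> [y []//|g y Sg [Sy Ky]]; split.
    by apply: subgroupM => //; apply: subgroupM => //; apply: subgroupV.
  by rewrite !KE KV; apply: (normal_conj nS1) => //; apply: J.
- move=> y z Sy Sz; have SV a : S i.+1 a -> S i.+1 a^-1 by apply: subgroupV.
  have SM a b : S i.+1 a -> S i.+1 b -> S i.+1 (a * b) by apply: subgroupM.
  by split; [auto 8|rewrite !KE !KV; apply: ab; apply: J].
- move=> y m Sy m0 [_ Ky]; split=> //; apply: (tf _ m) => //; first exact: J.
  by have := conj_zexpg y h m => /= <-.
Qed.

(** Otherwise all of S i would preserve degrees on S (i+1), and S i / S (i+2) would be bi-orderable.
    Quantifying over [psi] after g keeps g independent of the chosen degree map. *)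
Lemma exists_inverting i : (i.+2 <= n)%N -> killed_by_tf_abelian i.+1 ->
  exists2 g, S i g & forall psi m, degree (S i.+1) (S i.+2) psi -> S i.+1 m ->
    psi (g^-1 * m * g) = (- psi m)%R.
Proof.
move=> lt claim; have lt' := ltnW lt.
have sS := series_subgroup (ltnW lt'); have sS1 := series_subgroup lt'.
have nS := series_normal lt'; have nS1 := series_normal lt.
have n2 := normal_two_steps lt claim.
have [phi dphi] := deg lt'; have [psi0 dpsi0] := deg lt.
have [g Sg ng] : exists2 g, S i g & ~ forall m, S i.+1 m -> psi0 (g^-1 * m * g) = psi0 m.
  apply: contrapT => no; apply: (nbi lt).
  apply: biorderable_of_preserving dphi dpsi0 n2 _ => // g m Sg Sm.
  by apply: contrapT => ne; apply: no; exists g => // /(_ m Sm).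
exists g => // psi m dpsi Sm.
have [e [e1|e1] eP] := conj_degree_sign sS nS dpsi n2 Sg; last by rewrite eP // e1 mulN1r.
have [e' [e1'|e1'] eP'] := conj_degree_sign sS nS dpsi0 n2 Sg.
  by case: ng => m' Sm'; rewrite eP' // e1' mul1r.
(* Two degree maps with the same kernel agree on whether g acts by -1. *)
exfalso; have [hp kp [u Su u1]] := dpsi0; have [hp' kp' _] := dpsi.
have Sc : S i.+1 (g^-1 * u * g) by exact: normal_conj nS Sg Su.
have SV : S i.+1 u^-1 by exact: subgroupV.
have : S i.+2 ((g^-1 * u * g) * u^-1).
  apply/kp'; first exact: subgroupM.
  by rewrite hp' // (homV sS1 hp') // eP // e1 mul1r subrr.
move/kp => /(_ (subgroupM sS1 Sc SV)); rewrite hp // (homV sS1 hp) // eP' // e1' u1.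
by lia.
Qed.

(** Let g invert S (k+1) / S (k+2), where S (k+2) lies in K by induction. Modulo K conjugation by g
    inverts x, but it also fixes x because S k / K is abelian. So x^2 lies in K, and
    torsion-freeness gives x. *)
Lemma abelian_kernel i : (i < n)%N -> killed_by_tf_abelian i.
Proof.
(* The index is rewritten as a distance from the bottom, so that ordinary induction goes up from the
   trivial term. *)
move=> lt; have -> : i = (n - (n - i.+1).+1)%N by lia.
have : ((n - i.+1) < n)%N by lia.
elim: (n - i.+1)%N => [|j IH] ltj K nK abK tfK x.
  have -> : (n - 1).+1 = n by lia.
  by have [_ [Sn _]] := ser; move=> /Sn ->; apply: subgroup1 (normal_subgroup nK).
have e : (n - j.+2).+1 = (n - j.+1)%N by lia.
have lt2 : ((n - j.+2).+2 <= n)%N by lia.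
move: IH nK abK tfK lt2 => /(_ (ltnW ltj)); rewrite -e => IH.
move: (n - j.+2)%N IH => {e ltj lt}k IH nK abK tfK lt2 Sx.
have sS := series_subgroup (ltnW (ltnW lt2)); have sS1 := series_subgroup (ltnW lt2).
have nS := series_normal (ltnW lt2); have nS1 := series_normal lt2.
have sub1 y : S k.+1 y -> S k y by exact: (normal_sub nS).
have sK := normal_subgroup nK.
have K2 y : S k.+2 y -> K y.
  move=> Sy; suff [] : S k.+1 y /\ K y by [].
  apply: (IH (fun y => S k.+1 y /\ K y)) Sy.
  - split; last first.
      split=> [z []//|h z Sh [Sz Kz]]; split; last by apply: (normal_conj nK); auto.
      by apply: subgroupM => //; apply: subgroupM => //; apply: subgroupV.
    split; first by split; apply: subgroup1.
    by split=> [a b [Sa Ka] [Sb Kb]|a [Sa Ka]]; split; (apply: subgroupM || apply: subgroupV).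
  - move=> a b Sa Sb; split; last by apply: abK; auto.
    have SV z : S k.+1 z -> S k.+1 z^-1 by apply: subgroupV.
    have SM z t : S k.+1 z -> S k.+1 t -> S k.+1 (z * t) by apply: subgroupM.
    by auto 8.
  - by move=> a m Sa m0 [_ Ka]; split=> //; apply: (tfK _ m); auto.
have [g Sg gP] := exists_inverting lt2 IH.
have [psi dpsi] := deg lt2; have [hp kp _] := dpsi.
have Sc : S k.+1 (g^-1 * x * g) by exact: normal_conj nS Sg Sx.
have Kc : K (g^-1 * x * g * x).
  apply/K2/kp; first exact: subgroupM.
  by rewrite hp // (gP psi) // addNr.
have Kc2 := abK _ _ (sub1 _ Sx) Sg.
apply: (tfK _ 2); auto.
have := subgroupM sK (normal_conjV sS nK (sub1 _ Sx) Kc) (subgroupV sK Kc2).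
by rewrite expg2; group_norm.
Qed.

End TararinSeries.

(** Equal terms have equal successors, each being the least kernel of a torsion-free abelian
    quotient; nontrivial factors prevent one series from outlasting the other. *)
Lemma tararin_series_unique (G : groupType) n m (S S' : nat -> G -> Prop) :
  tararin_series n S -> (forall i, (i < n)%N -> exists psi, degree (S i) (S i.+1) psi) ->
  tararin_series m S' -> (forall i, (i < m)%N -> exists psi, degree (S' i) (S' i.+1) psi) ->
  m = n /\ forall i, (i <= n)%N -> forall x, S' i x <-> S i x.
Proof.
move=> [ser [rk nb]] deg [ser' [rk' nb']] deg'.
have eqS i : (i <= n)%N -> (i <= m)%N -> S' i = S i.
  elim: i => [_ _|i IH ltn ltm].
    by apply/funext=> x; apply/propext; have [? _] := ser; have [? _] := ser'.
  have e := IH (ltnW ltn) (ltnW ltm); apply/funext=> x; apply/propext; split=> Sx.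
    apply: (abelian_kernel ser' deg' nb' ltm _ _ _ Sx); rewrite e.
    - exact: (series_normal ser ltn).
    - by have [] := rk _ ltn.
    - by have [_ []] := rk _ ltn.
  apply: (abelian_kernel ser deg nb ltn _ _ _ Sx); rewrite -e.
  - exact: (series_normal ser' ltm).
  - by have [] := rk' _ ltm.
  - by have [_ []] := rk' _ ltm.
have [[_ [Sn _]] [_ [Sm' _]]] := (ser, ser').
have mn : m = n.
  case: (ltngtP m n) => // lt; exfalso.
    have [_ [_ [[x [Sx nSx]] _]]] := rk _ lt.
    apply: nSx; move: Sx; rewrite -(eqS _ (ltnW lt) (leqnn m)) => /Sm' ->.
    by apply: subgroup1; exact: (series_subgroup ser lt).
  have [_ [_ [[x [Sx nSx]] _]]] := rk' _ lt.
  apply: nSx; move: Sx; rewrite (eqS _ (leqnn n) (ltnW lt)) => /Sn ->.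
  by apply: subgroup1; exact: (series_subgroup ser' lt).
by split=> // i le x; rewrite eqS // mn.
Qed.

(** * Left-orders of Tararin poly-Z groups *)

Lemma left_order_cone (G : groupType) (lt : G -> G -> Prop) :
  left_order lt -> cone (fun _ => True) (positive_cone lt).
Proof.
case=> irr [tr [tot inv]]; split=> // [|x y Px Py|x _]; first exact: irr.
  by apply: tr Px _; have := inv x _ _ Py; rewrite mulg1.
case: (EM (x = 1)) => [->|x1]; first exact: Or31.
case: (tot _ _ x1) => [lx|lx]; last exact: Or32.
by apply: Or33; have := inv x^-1 _ _ lx; rewrite mulVg mulg1.
Qed.

Lemma cone_left_order (G : groupType) (P : G -> Prop) :
  cone (fun _ => True) P -> left_order (fun x y => P (x^-1 * y)).
Proof.
case=> _ P1 PM tot; split=> [x|]; first by rewrite mulVg.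
split=> [x y z Px Py|].
  by have := PM _ _ Px Py; rewrite mulgA mulgK.
split=> [x y xy|g x y Pxy]; last by rewrite invgM mulgA mulgVK.
have [e|Pxy|Pxy] := tot (x^-1 * y) I; [|by left|by right; move: Pxy; rewrite invgM invgK].
by case: xy; rewrite -(mulg1 x) -e mulgA mulgV mul1g.
Qed.

Lemma word_evalM (G : groupType) (X : Type) (f : X -> G) w w' :
  word_eval f (w ++ w') = word_eval f w * word_eval f w'.
Proof. by elim: w => [|x w IH]; rewrite /= ?mul1g // IH mulgA. Qed.

Section TararinRegular.
Variables (G : groupType) (n : nat) (S : nat -> G -> Prop) (P : G -> Prop).
Hypothesis ser : subnormal_series n S.
Hypothesis deg : forall i, (i < n)%N -> exists psi, degree (S i) (S i.+1) psi.
Hypothesis nbi : forall i, (i.+2 <= n)%N -> ~ quotient_biorderable (S i) (S i.+2).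
Hypothesis coneP : cone (fun _ => True) P.

Lemma positive_generator i : (i < n)%N -> exists psi t,
  [/\ degree (S i) (S i.+1) psi, S i t, psi t = 1%R & P t].
Proof.
move=> lt; have [psi dpsi] := deg lt; have [hp kp [t St t1]] := dpsi.
have sS := series_subgroup ser (ltnW lt).
have [_ _ _ /(_ t I) [e|Pt|Pt]] := coneP.
- by move: t1; rewrite e (hom1 sS hp).
- by exists psi, t.
have t1' : psi t^-1 = (-1)%R by rewrite (homV sS hp) // t1.
exists (fun x => - psi x)%R, t^-1; split=> //; [|exact: subgroupV|by rewrite t1'].
split=> [x y Sx Sy|x Sx|]; first by rewrite hp // opprD.
  by rewrite kp //; split=> [->|/eqP]; rewrite ?oppr0 // oppr_eq0 => /eqP.
by exists t^-1; [exact: subgroupV|rewrite t1'].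
Qed.

(** The elements of S i acting trivially on S (i+1) / S (i+2) form a subgroup containing S (i+1),
    since this factor is abelian. If [t] were among them they would exhaust S i, although some
    element inverts. *)
Lemma generator_inverts i phi t psi m : (i.+2 <= n)%N ->
  degree (S i) (S i.+1) phi -> S i t -> phi t = 1%R ->
  degree (S i.+1) (S i.+2) psi -> S i.+1 m ->
  psi (t^-1 * m * t) = (- psi m)%R.
Proof.
move=> lt dphi St t1 dpsi Sm; have lt' := ltnW lt.
have sS := series_subgroup ser (ltnW lt'); have sS1 := series_subgroup ser lt'.
have nS := series_normal ser lt'.
have claim := abelian_kernel ser deg nbi lt.
have n2 := normal_two_steps ser deg lt claim.
have [e [e1|->] eP] := conj_degree_sign sS nS dpsi n2 St; last by rewrite eP // mulN1r.
have [g Sg gP] := exists_inverting ser deg nbi lt claim.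
exfalso; have [hp kp [u Su u1]] := dpsi; have [hphi kphi _] := dphi.
pose K h := S i h /\ forall m, S i.+1 m -> psi (h^-1 * m * h) = psi m.
have J h y : S i h -> S i.+1 y -> S i.+1 (h^-1 * y * h) by exact: (normal_conj nS).
have sK : is_subgroup K.
  split; first by split=> [|y Sy]; [exact: subgroup1|congr psi; group_norm].
  split=> [x y [Sx Kx] [Sy Ky]|x [Sx Kx]]; split=> [|z Sz].
  - exact: subgroupM.
  - have -> : (x * y)^-1 * z * (x * y) = y^-1 * (x^-1 * z * x) * y by group_norm.
    by rewrite Ky ?Kx //; exact: J.
  - exact: subgroupV.
  - rewrite -Kx; last by apply: J => //; exact: subgroupV.
    by congr psi; group_norm.
have Kt : K t by split=> // y Sy; rewrite eP // e1 mul1r.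
have Kg : K g.
  have Stk : S i (zexpg t (phi g)) by exact: subgroup_zexpg.
  have Sr : S i.+1 ((zexpg t (phi g))^-1 * g).
    apply/kphi; first by apply: subgroupM => //; apply: subgroupV.
    rewrite hphi ?(homV sS hphi) ?(hom_zexpg sS hphi) //; last exact: subgroupV.
    by rewrite t1 intz addNr.
  rewrite -[g](mulVKg (zexpg t (phi g))); apply: subgroupM => //; first exact: subgroup_zexpg.
  split=> [|y Sy]; first exact: (normal_sub nS).
  exact: (hom_conj sS1 hp).
by have := gP psi u dpsi Su; rewrite Kg.2 // u1.
Qed.

Section Signs.
Variables (psi : nat -> G -> int) (t : nat -> G).
Hypothesis gen : forall i, (i < n)%N ->
  [/\ degree (S i) (S i.+1) (psi i), S i (t i), psi i (t i) = 1%R & P (t i)].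

Lemma generator_remainder i s : (i < n)%N -> S i s ->
  S i.+1 ((zexpg (t i) (psi i s))^-1 * s).
Proof.
move=> lt Ss; have [[hp kp _] St t1 Pt] := gen lt.
have sS := series_subgroup ser (ltnW lt).
have Sz : S i (zexpg (t i) (psi i s)) by exact: subgroup_zexpg.
apply/kp; first by apply: subgroupM => //; exact: subgroupV.
rewrite hp ?(homV sS hp) ?(hom_zexpg sS hp) //; last exact: subgroupV.
by rewrite t1 intz addNr.
Qed.

Lemma positive_degree i s : (i < n)%N -> (forall r, S i.+1 r -> P (t i * r)) ->
  S i s -> (0 < psi i s)%R -> P s.
Proof.
move=> lt tr Ss; have := generator_remainder lt Ss; have [_ _ _ Pt] := gen lt.
have [_ _ PM _] := coneP.
case: (psi i s) => [[|k]|k] //= Sr _.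
rewrite -[s](mulVKg (t i ^+ k.+1)); move: Sr; set r := _ * s => /tr Pr.
by elim: k {r} (r) Pr => // k IH r Pr; rewrite expgS -mulgA; apply: PM => //; exact: IH.
Qed.

(** By the sign of the degree of s. If negative, t s = (t s t^-1) t, and conjugation has made the
    degree positive. If zero, insert the next generator u: in t s = (t u^-1) (u s) the first factor
    is a negative case and the second is covered by induction. *)
Lemma generator_dominates i s : (i < n)%N -> S i.+1 s -> P (t i * s).
Proof.
move=> lt; have -> : i = (n - (n - i.+1).+1)%N by lia.
have : ((n - i.+1) < n)%N by lia.
elim: (n - i.+1)%N s => [|j IH] s ltj.
  have -> : (n - 1).+1 = n by lia.
  have [_ [Sn _]] := ser; move=> /Sn ->; rewrite mulg1.
  by have [] := gen (_ : n - 1 < n)%N; first by lia.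
have e : (n - j.+2).+1 = (n - j.+1)%N by lia.
have lt2 : ((n - j.+2).+2 <= n)%N by lia.
move: IH lt2 => IH; have {}IH := fun r => IH r (ltnW ltj); move: IH; rewrite -e.
move: (n - j.+2)%N => {e ltj lt i}i IH lt Ss; have lt' := ltnW lt.
have sS1 := series_subgroup ser lt'; have sS := series_subgroup ser (ltnW lt').
have [d St t1 Pt] := gen lt'; have [d1 Su u1 Pu] := gen lt.
have [hp kp _] := d1; have [_ _ PM _] := coneP.
have pos r : S i.+1 r -> (0 < psi i.+1 r)%R -> P r.
  by apply: positive_degree => // r' Sr'; exact: IH.
have nS := series_normal ser lt'.
have neg r : S i.+1 r -> (psi i.+1 r < 0)%R -> P (t i * r).
  move=> Sr rn; have Sr' : S i.+1 (t i * r * (t i)^-1) by exact: (normal_conjV sS nS).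
  have -> : t i * r = (t i * r * (t i)^-1) * t i by group_norm.
  apply: PM => //; apply: pos => //.
  have := generator_inverts lt d St t1 d1 Sr'.
  have -> : (t i)^-1 * (t i * r * (t i)^-1) * t i = r by group_norm.
  by move: rn => /[swap] ->; rewrite oppr_lt0.
case: (ltgtP (psi i.+1 s) 0%R) => [sn|sp|s0]; first exact: neg.
  by apply: PM => //; exact: pos.
have S2 : S i.+2 s by apply/kp.
have -> : t i * s = (t i * (t i.+1)^-1) * (t i.+1 * s) by group_norm.
apply: PM; last exact: IH.
by apply: neg; [exact: subgroupV|rewrite (homV sS1 hp) // u1].
Qed.

Let X : finType := ('I_n * bool)%type.
Let f (x : X) : G := if x.2 then t x.1 else (t x.1)^-1.

Lemma word_eval_nseq k x : word_eval f (nseq k x) = f x ^+ k.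
Proof. by elim: k => //= k ->; rewrite expgS. Qed.

Lemma series_words i g : (i <= n)%N -> S i g -> exists2 w : seq X,
  all (fun x : X => (i <= x.1)%N) w & word_eval f w = g.
Proof.
move=> le; have -> : i = (n - (n - i))%N by lia.
elim: (n - i)%N (leq_subr i n) g => [_|j IH lt] g.
  by rewrite subn0; have [_ [Sn _]] := ser; move=> /Sn ->; exists [::].
have lt' : (n - j.+1 < n)%N by lia.
move=> Sg; have := generator_remainder lt' Sg.
have -> : (n - j.+1).+1 = (n - j)%N by lia.
move=> /(IH (ltnW lt)) [w wl wE].
pose k := psi (n - j.+1)%N g; pose x b : X := (Ordinal lt', b).
exists (nseq `|k| (x (0 <= k)%R) ++ w).
  rewrite all_cat; apply/andP; split; first by apply/allP=> y /nseqP[-> _] /=.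
  by apply/allP => y /(allP wl) /=; lia.
rewrite word_evalM word_eval_nseq wE -/k /f /=; case: k => m /=; first exact: mulVKg.
by rewrite expVgn invgK mulKg.
Qed.

(** The state [Some None] is initial and [None] is a sink; [Some (Some i)] remembers the leading
    generator, which may recur only with positive sign. *)
Let delta (q : option (option 'I_n)) (x : X) : option (option 'I_n) :=
  match q with
  | None => None
  | Some None => if x.2 then Some (Some x.1) else None
  | Some (Some i) => if (x == (i, true)) || (i < x.1)%N then q else None
  end.
Let accepting (q : option (option 'I_n)) := if q is Some (Some _) then true else false.

Lemma accepts_dead w : accepting (foldl delta None w) = false.
Proof. by elim: w. Qed.

Lemma accepts_level i w : accepting (foldl delta (Some (Some i)) w) =
  all (fun x : X => (x == (i, true)) || (i < x.1)%N) w.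
Proof.
elim: w => //= x w IH; case: ifP => _ /=; first exact: IH.
exact: accepts_dead.
Qed.

Lemma level_word_degree (i : 'I_n) (w : seq X) :
  all (fun x : X => (x == (i, true)) || (i < x.1)%N) w ->
  S i (word_eval f w) /\ (0 <= psi i (word_eval f w))%R.
Proof.
have lt := ltn_ord i; have [[hp kp _] St t1 Pt] := gen lt.
have sS := series_subgroup ser (ltnW lt); have sS1 := series_subgroup ser lt.
elim: w => [_|x w IH /=]; first by rewrite /= (hom1 sS hp); split=> //; exact: subgroup1.
case/andP=> xi /IH [Sw pw].
suff [Sx px] : S i (f x) /\ (0 <= psi i (f x))%R.
  by split; [exact: subgroupM|rewrite hp // addr_ge0].
case/orP: xi => [/eqP ->|ix]; first by rewrite /f /= t1.
have Sx : S i.+1 (f x).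
  have [_ Sx _ _] := gen (ltn_ord x.1).
  have Sx' : S i.+1 (t x.1) by apply: (series_sub ser ix (ltnW (ltn_ord x.1))).
  by rewrite /f; case: (x.2) => //; exact: subgroupV.
have Six : S i (f x) by exact: (normal_sub (series_normal ser lt)).
by split=> //; rewrite ((kp _ Six).1 Sx).
Qed.

Lemma series_cone_regular : exists (X : finType) (f : X -> G),
    (forall g, exists w, word_eval f w = g) /\
    exists (Q : finType) (q0 : Q) (delta : Q -> X -> Q) (F : Q -> bool),
      forall g, P g <-> exists w, dfa_accepts q0 delta F w /\ word_eval f w = g.
Proof.
have [S0 [Sn _]] := ser; have [_ P1 PM tot] := coneP.
exists X, f; split=> [g|]; first by have [w _ wE] := series_words (leq0n n) (S0 g); exists w.
exists (option (option 'I_n)), (Some None), delta, accepting => g; split; last first.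
  case=> -[|x w] [] //; rewrite /dfa_accepts /=; case: x => i [] /=; last by rewrite accepts_dead.
  rewrite accepts_level => /level_word_degree [Sw pw] <-.
  have lt := ltn_ord i; have [[hp kp _] St t1 Pt] := gen lt.
  apply: (positive_degree lt (fun r => generator_dominates lt)).
    by apply: subgroupM => //; exact: (series_subgroup ser (ltnW lt)).
  by rewrite hp //= t1 ltr_wpDr.
move=> Pg; have [i lt [Sg nSg]] : exists2 i, (i < n)%N & S i g /\ ~ S i.+1 g.
  apply: contrapT => no; have Sall i : (i <= n)%N -> S i g.
    elim: i => [//|i IH lt]; apply: contrapT => nS; apply: no; exists i => //.
    by split=> //; apply: IH; exact: ltnW.
  by have /Sn g1 := Sall n (leqnn n); apply: P1; rewrite -g1.
have [[hp kp _] St t1 Pt] := gen lt; have sS := series_subgroup ser (ltnW lt).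
have gp : (0 < psi i g)%R.
  case: (ltgtP (psi i g) 0%R) => // [gn|g0]; last by case: nSg; apply/kp.
  exfalso; apply: (coneVF coneP Pg).
  apply: (positive_degree lt (fun r => generator_dominates lt)); first exact: subgroupV.
  by rewrite (homV sS hp) // oppr_gt0.
have [w wl wE] := series_words lt (generator_remainder lt Sg).
case E : (psi i g) gp wE => [[|k]|k] // _ wE.
exists (nseq k.+1 (Ordinal lt, true) ++ w); split; last first.
  by rewrite word_evalM word_eval_nseq wE /f /= mulVKg.
rewrite /dfa_accepts /= accepts_level all_cat; apply/andP; split.
  by apply/allP=> y /nseqP[-> _]; rewrite eqxx.
by apply/allP=> y /(allP wl) /= ->; rewrite orbT.
Qed.

End Signs.

End TararinRegular.

Lemma tararin_regular (G : groupType) n (S : nat -> G -> Prop) (lt : G -> G -> Prop) :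
  tararin_series n S ->
  (forall i, (i < n)%N -> exists psi, degree (S i) (S i.+1) psi) ->
  left_order lt -> regular_left_order lt.
Proof.
move=> [ser [_ nb]] deg /left_order_cone cP.
have gen i : exists pt : (G -> int) * G, (i < n)%N ->
    [/\ degree (S i) (S i.+1) pt.1, S i pt.2, pt.1 pt.2 = 1%R & positive_cone lt pt.2].
  case: (EM (i < n)%N) => [lti|]; last by exists (fun=> 0%R, 1).
  by have [psi [t p]] := positive_generator ser deg cP lti; exists (psi, t).
have [pt ptP] := choice gen.
exact: (series_cone_regular (psi := fun i => (pt i).1) (t := fun i => (pt i).2) ser deg nb cP ptP).
Qed.

(** * Regular cones *)

Section RegularCones.
Variable G : groupType.
Implicit Types (H K P : G -> Prop).

Definition regular_cone H P :=
  exists (X : finType) (f : X -> G), (forall x, H (f x)) /\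
    exists (Q : finType) (q0 : Q) (delta : Q -> X -> Q) (F : Q -> bool),
      forall g, P g <-> exists w, dfa_accepts q0 delta F w /\ word_eval f w = g.

Definition all_cones_regular H :=
  [/\ is_subgroup H, exists P, cone H P & forall P, cone H P -> regular_cone H P].

Lemma subgroup_word_eval (X : Type) (f : X -> G) H w :
  is_subgroup H -> (forall x, H (f x)) -> H (word_eval f w).
Proof.
by move=> sH Hf; elim: w => [|a w IH]; [exact: subgroup1|exact: subgroupM].
Qed.

(** The letters of an automaton for a single cone already generate, since every element is trivial,
    positive, or the inverse of a positive one. *)
Lemma all_cones_regular_fg H : all_cones_regular H -> fg_subgroup H.
Proof.
case=> sH [P cP] /(_ P cP) [X [f [Hf [Q [q0 [delta [F PE]]]]]]].
exists (codom f) => [x /codomP[a ->]//|K sK Kf h Hh].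
have KP g : P g -> K g.
  move=> /PE[w [_ <-]]; apply: subgroup_word_eval => // a; apply: Kf; exact: codom_f.
have [_ _ _ /(_ h Hh) [->|/KP//|/KP]] := cP; first exact: subgroup1.
by move/(subgroupVE _ sK).
Qed.

Lemma fg_countable H : fg_subgroup H ->
  exists e : nat -> G, forall h, H h -> exists n, e n = h.
Proof.
case=> gens gH genP.
pose l (p : bool * nat) := if p.1 then nth 1 gens p.2 else (nth 1 gens p.2)^-1.
exists (fun n => if unpickle n is Some w then word_eval l w else 1) => h Hh.
suff [w <-] : exists w, word_eval l w = h by exists (pickle w); rewrite pickleK.
move: h Hh; apply: genP.
  split; first by exists [::].
  split=> [x y [w <-] [w' <-]|x [w <-]]; first by exists (w ++ w'); rewrite word_evalM.
  elim: w => [|[b i] w [w' w'E]]; first by exists [::]; rewrite /= invg1.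
  exists (w' ++ [:: (~~ b, i)]); rewrite word_evalM w'E /= mulg1 invgM; congr (_ * _).
  by case: b; rewrite /l /= ?invgK.
move=> x xg; exists [:: (true, index x gens)].
by rewrite /= mulg1 /l /= nth_index.
Qed.

(** Once alphabet and states are renumbered by ordinals and letters are named by indices in [e], an
    automaton is an element of a countable type. *)
Lemma regular_cones_countable H (e : nat -> G) :
  (forall h, H h -> exists n, e n = h) ->
  exists E : nat -> G -> Prop, forall P, regular_cone H P ->
    exists n, forall g, P g <-> E n g.
Proof.
move=> eP.
pose code := {nm : nat * nat & ({ffun 'I_nm.1 -> nat} * 'I_nm.2 *
   {ffun 'I_nm.2 * 'I_nm.1 -> 'I_nm.2} * {ffun 'I_nm.2 -> bool})%type}.
pose dec (c : code) (g : G) : Prop := let: existT nm (f, q0, d, F) := c in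
  exists w : seq 'I_nm.1, F (foldl (fun q a => d (q, a)) q0 w) /\
    word_eval (fun i => e (f i)) w = g.
exists (fun n g => if unpickle n is Some c then dec c g else False).
move=> P [X [f [Hf [Q [q0 [delta [F PE]]]]]]].
have [k kP] := choice (fun x => eP _ (Hf x)).
pose c : code := existT _ (#|X|, #|Q|) ([ffun i : 'I_#|X| => k (enum_val i)], enum_rank q0,
  [ffun p : 'I_#|Q| * 'I_#|X| => enum_rank (delta (enum_val p.1) (enum_val p.2))],
  [ffun q : 'I_#|Q| => F (enum_val q)]).
exists (pickle c) => g; rewrite pickleK PE /=.
have run q w : foldl (fun (q : 'I_#|Q|) a =>
      [ffun p : 'I_#|Q| * 'I_#|X| => enum_rank (delta (enum_val p.1) (enum_val p.2))] (q, a))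
    (enum_rank q) w = enum_rank (foldl delta q (map enum_val w)).
  by elim: w q => //= a w IH q; rewrite ffunE /= enum_rankK IH.
have ev w : word_eval (fun i : 'I_#|X| => e ([ffun i : 'I_#|X| => k (enum_val i)] i)) w =
    word_eval f (map enum_val w).
  by elim: w => //= a w ->; rewrite ffunE kP.
split=> [[w [acc wE]]|[w [acc wE]]].
  have wK : map enum_val (map enum_rank w) = w.
    by rewrite -map_comp map_id_in // => a _ /=; rewrite enum_rankK.
  by exists (map enum_rank w); rewrite run ev wK ffunE enum_rankK.
exists (map enum_val w); rewrite -ev; split=> //.
by move: acc; rewrite run ffunE enum_rankK.
Qed.

(* A word of the lexicographic language that evaluates into the kernel has prefixes of bounded
   degree, since every prefix and every suffix is a bounded factor away from the positive cone;
   so a finite automaton can track the degree and rewrite the word in Schreier generators. *)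
Lemma all_cones_regular_kernel H K psi :
  normal_in K H -> degree H K psi -> all_cones_regular H -> all_cones_regular K.
Proof.
move=> nK [hp kp [t Ht t1]] [sH [P0 [P0H P01 P0M P0tot]] reg].
have sK := normal_subgroup nK; split=> //.
  exists (fun x => P0 x /\ K x); split=> [x []//|[]//|x y [? ?] [? ?]|x Kx].
    by split; [exact: P0M|exact: subgroupM].
  have [->|?|?] := P0tot x (normal_sub nK Kx); [exact: Or31|exact: Or32|apply: Or33].
  by split=> //; exact: subgroupV.
move=> R cR; have [RK _ _ _] := cR.
have KE x : K x <-> H x /\ psi x = 0%R.
  split=> [Kx|[Hx x0]]; last exact/kp.
  by have Hx := normal_sub nK Kx; split=> //; exact/kp.
have cR' : cone (fun x => H x /\ psi x = 0%R) R.
  by rewrite (_ : (fun _ => _) = K) //; apply/funext => x; apply/propext; rewrite KE.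
have [X [f [Hf [Q [q0 [delta [F PE]]]]]]] := reg _ (lex_cone sH hp cR').
have Hw w : H (word_eval f w) by exact: subgroup_word_eval.
pose d w := psi (word_eval f w).
have dM w w' : d (w ++ w') = (d w + d w')%R by rewrite /d word_evalM hp.
have acc_ge0 w : F (foldl delta q0 w) -> (0 <= d w)%R.
  move=> acc; have [|_ [/ltW//|/RK/KE[_]]] := (PE (word_eval f w)).2; first by exists w.
  by rewrite /d => ->.
have exc q : exists w, (exists w', F (foldl delta q w')) -> F (foldl delta q w).
  by case: (EM (exists w', F (foldl delta q w'))) => [[w Fw]|no]; [exists w|exists [::]].
have exr q : exists w, (exists w', foldl delta q0 w' = q) -> foldl delta q0 w = q.
  by case: (EM (exists w', foldl delta q0 w' = q)) => [[w Fw]|no]; [exists w|exists [::]].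
have [c cP] := choice exc; have [r rP] := choice exr.
(* [r q] is a fixed word reaching q and [c q] a fixed word leading from q to acceptance. Accepted
   words have nonnegative degree, so replacing a suffix by [c q] bounds the prefix degree below, and
   replacing the prefix by [r q] bounds it above. *)
pose C := \max_(q : Q) maxn `|d (c q)| `|d (r q)|.
have bound w1 w2 : F (foldl delta q0 (w1 ++ w2)) -> d (w1 ++ w2) = 0%R -> (`|d w1| <= C)%N.
  move=> acc d0; pose q := foldl delta q0 w1.
  have b1 : (maxn `|d (c q)| `|d (r q)| <= C)%N by exact: (leq_bigmax q).
  have a1 : (0 <= d (w1 ++ c q))%R.
    apply: acc_ge0; rewrite foldl_cat -/q; apply: cP.
    by exists w2; move: acc; rewrite foldl_cat.
  have a2 : (0 <= d (r q ++ w2))%R.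
    apply: acc_ge0; rewrite foldl_cat rP; last by exists w1.
    by move: acc; rewrite foldl_cat.
  move: a1 a2 d0 b1; rewrite !dM; move: (d w1) (d w2) (d (c q)) (d (r q)) => a b a' b'.
  lia.
(* Levels encode the degrees from -C to C, shifted by C. A consistent triple (m, x, m') stands for
   the Schreier generator t^m f(x) t^(-m'); inconsistent triples evaluate to 1 and are rejected by
   the automaton. *)
pose L : finType := 'I_(C + C).+1.
pose lev (m : L) : int := (m%:Z - C%:Z)%R.
have lev_inj m m' : lev m = lev m' -> m = m' by rewrite /lev => e; apply/val_inj => /=; lia.
have lev_ex (k : int) : (`|k| <= C)%N -> exists m, lev m = k.
  move=> kC; have lt : (`|(k + C%:Z)%R| < (C + C).+1)%N by lia.
  by exists (Ordinal lt); rewrite /lev /=; lia.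
pose Y : finType := (L * X * L)%type.
pose ok (y : Y) := (lev y.1.1 + psi (f y.1.2) == lev y.2)%R.
pose fY (y : Y) := if ok y then zexpg t (lev y.1.1) * f y.1.2 * (zexpg t (lev y.2))^-1 else 1.
have Hz k : H (zexpg t k) by exact: subgroup_zexpg.
have KfY y : K (fY y).
  rewrite /fY; case: ifP => [/eqP oky|_]; last exact: subgroup1.
  have Hz1 : H (zexpg t (lev y.1.1) * f y.1.2) by exact: subgroupM.
  have HzV : H (zexpg t (lev y.2))^-1 by exact: subgroupV.
  apply/kp; first exact: subgroupM.
  by rewrite !hp // (homV sH hp) // !(hom_zexpg sH hp) // t1 !intz oky subrr.
pose fX (a : Y * bool) := if a.2 then fY a.1 else (fY a.1)^-1.
pose step (s : option (Q * L)) (a : Y * bool) :=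
  if s is Some (q, m) then
    if [&& a.2, a.1.1.1 == m & ok a.1] then Some (delta q a.1.1.2, a.1.2) else None
  else None.
have [m0 m0E] := lev_ex 0%R (leq0n C).
pose acc (s : option (Q * L)) := if s is Some (q, m) then F q && (m == m0) else false.
have KfX a : K (fX a) by rewrite /fX; case: a => y [] //=; exact: subgroupV.
have stepN w : foldl step None w = None by elim: w.
have sound w q m q' m' : foldl step (Some (q, m)) w = Some (q', m') ->
    exists2 v, foldl delta q v = q' &
      word_eval fX w = zexpg t (lev m) * word_eval f v * (zexpg t (lev m'))^-1.
  elim: w q m => [|[[[m1 x] m2] b] w IH] q m /=.
    by case=> -> ->; exists [::] => //=; rewrite mulg1 mulgV.
  case: ifP => [/and3P[/= b1 /eqP e1 oky]|_]; last by rewrite stepN.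
  move=> /IH [v vE wE]; exists (x :: v) => //.
  by rewrite wE /fX /= b1 /fY oky /= e1; group_norm.
have complete v q m : (forall v1 v2, v = v1 ++ v2 -> (`|(lev m + d v1)%R| <= C)%N) ->
    exists2 w, word_eval fX w = zexpg t (lev m) * word_eval f v * (zexpg t (lev m + d v)%R)^-1 &
      exists2 m', lev m' = (lev m + d v)%R & foldl step (Some (q, m)) w = Some (foldl delta q v, m').
  have d0 : d [::] = 0%R by rewrite /d /= (hom1 sH hp).
  elim: v q m => [|x v IH] q m bd.
    exists [::]; first by rewrite /= d0 addr0 mulg1 mulgV.
    by exists m; rewrite ?d0 ?addr0.
  have d1 : d [:: x] = psi (f x) by rewrite /d /= mulg1.
  have [m1 m1E] := lev_ex _ (bd [:: x] v erefl); rewrite d1 in m1E.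
  have [v1 v2 vE|w wE [m' m'E run]] := IH (delta q x) m1.
    rewrite m1E -addrA -d1 -dM; apply: (bd (x :: v1) v2); by rewrite vE.
  have oky : ok (m, x, m1) by rewrite /ok /= m1E.
  have dE : (lev m1 + d v = lev m + d (x :: v))%R by rewrite m1E -addrA -d1 -dM.
  exists (((m, x, m1), true) :: w).
    by rewrite /= wE /fX /= /fY oky /= dE; group_norm.
  exists m'; first by rewrite m'E dE.
  by rewrite /= eqxx oky /= run.
exists (Y * bool)%type, fX; split=> //.
exists (option (Q * L))%type, (Some (q0, m0)), step, acc => g; split.
  move=> Rg; have Kg := RK _ Rg; have [Hg g0] := (KE g).1 Kg.
  have [|v [av vE]] := (PE g).1; first by split=> //; right.
  have dv : d v = 0%R by rewrite /d vE.
  have [|w wE [m' m'E run]] := complete v q0 m0.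
    by move=> v1 v2 e; rewrite m0E add0r; apply: (bound v1 v2); rewrite -e.
  exists w; split; last by rewrite wE vE dv m0E /= mul1g invg1 mulg1.
  rewrite /dfa_accepts run /=; apply/andP; split=> //.
  by apply/eqP/lev_inj; rewrite m'E dv addr0.
case=> w [+ wE]; rewrite /dfa_accepts; case run: (foldl _ _ _) => [[q' m']|] //= /andP[Fq /eqP e].
have [v vE wE'] := sound _ _ _ _ _ run.
have Kg : K g by rewrite -wE; exact: subgroup_word_eval.
have gE : word_eval f v = g by rewrite -wE wE' e m0E /= mul1g invg1 mulg1.
have [|_ [|//]] := (PE g).2; first by exists v; split=> //; rewrite /dfa_accepts vE.
by have [_ ->] := (KE g).1 Kg; rewrite ltxx.
Qed.

End RegularCones.

(** * The space of cones *)

Section SpaceOfCones.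
Variables (G : groupType) (e : nat -> G).
Hypothesis e_surj : forall g, exists n, e n = g.
Implicit Types (p q r : G -> bool) (K : (G -> bool) -> Prop).

(** Boolean predicates on [G] are points of a Cantor space whose coordinates are listed by [e];
    [agree n] describes its basic neighbourhoods. *)
Definition agree n p q := forall i, (i < n)%N -> p (e i) = q (e i).
Definition closed_set K := forall p, (forall n, exists2 q, K q & agree n p q) -> K p.
Definition conj_fun (g : G) p : G -> bool := fun x => p (g^-1 * x * g).
Definition is_cone p := cone (fun _ => True) (fun x => p x).
Definition cylinder (s : seq bool) p :=
  forall i, (i < size s)%N -> p (e i) = nth false s i.

Lemma agree_sym n p q : agree n p q -> agree n q p.
Proof. by move=> a i /a. Qed.

Lemma agree_trans n p q r : agree n p q -> agree n q r -> agree n p r.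
Proof. by move=> a b i lt; rewrite a ?b. Qed.

Lemma agree_leq m n p q : (m <= n)%N -> agree n p q -> agree m p q.
Proof. by move=> mn a i lt; apply: a; apply: leq_trans lt mn. Qed.

Lemma agree_at g : exists n, forall p q, agree n p q -> p g = q g.
Proof. by have [n <-] := e_surj g; exists n.+1 => p q; apply. Qed.

(** Compactness, by König's lemma: a finite pattern realised in every [K n] can be prolonged by one
    bit keeping this property, because the sets decrease. *)
Lemma compact_cylinders (K : nat -> (G -> bool) -> Prop) :
  (forall n, closed_set (K n)) -> (forall n, exists p, K n p) ->
  (forall n p, K n.+1 p -> K n p) -> exists p, forall n, K n p.
Proof.
move=> clK neK decK.
have dec m n p : (m <= n)%N -> K n p -> K m p.
  elim: n => [|n IH]; first by rewrite leqn0 => /eqP->.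
  by rewrite leq_eqVlt => /orP[/eqP->//|mn] /decK; exact: IH.
pose good s := forall n, exists2 p, K n p & cylinder s p.
have cyl_rcons s b p : cylinder s p -> p (e (size s)) = b -> cylinder (rcons s b) p.
  move=> c pb i; rewrite size_rcons nth_rcons ltnS leq_eqVlt => /orP[/eqP->|lt].
    by rewrite ltnn eqxx.
  by rewrite lt; exact: c.
have ext s : exists b, good s -> good (rcons s b).
  apply: contrapT => no.
  have fail b : good s /\ exists n, forall p, K n p -> ~ cylinder (rcons s b) p.
    apply: contrapT => nf; apply: no; exists b => gs n; apply: contrapT => np.
    by apply: nf; split=> //; exists n => p Kp cp; apply: np; exists p.
  have [gs [n1 f1]] := fail true; have [_ [n2 f2]] := fail false.
  have [p Kp cp] := gs (maxn n1 n2).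
  case E : (p (e (size s))).
    by apply: (f1 p); [exact: dec (leq_maxl _ _) Kp|exact: cyl_rcons].
  by apply: (f2 p); [exact: dec (leq_maxr _ _) Kp|exact: cyl_rcons].
have [b bP] := choice ext.
pose sig := fix sig n := if n is n'.+1 then rcons (sig n') (b (sig n')) else [::].
have sigS n : size (sig n) = n by elim: n => //= n IH; rewrite size_rcons IH.
have gsig n : good (sig n).
  elim: n => [n|n IH]; last exact: bP.
  by have [p Kp] := neK n; exists p.
pose p0 i := nth false (sig i.+1) i.
have sigE n i : (i < n)%N -> nth false (sig n) i = p0 i.
  elim: n => // n IH; rewrite ltnS leq_eqVlt => /orP[/eqP->//|lt].
  by rewrite /= nth_rcons sigS lt IH.
(* [e] may repeat values, so the limit is read at a chosen index, and any two indices of the same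
   element must be shown to carry the same bit. *)
have [idx idxP] := choice e_surj.
have pE i : p0 (idx (e i)) = p0 i.
  have [p _ cp] := gsig (maxn i (idx (e i))).+1 0%N.
  have lt1 : (i < (maxn i (idx (e i))).+1)%N by rewrite ltnS leq_maxl.
  have lt2 : (idx (e i) < (maxn i (idx (e i))).+1)%N by rewrite ltnS leq_maxr.
  by rewrite -(sigE _ _ lt1) -(sigE _ _ lt2) -!cp ?sigS // idxP.
exists (fun g => p0 (idx g)) => n; apply: clK => m.
have [p Kp cp] := gsig m n; exists p => // i lt.
by rewrite pE -(sigE m) // cp ?sigS.
Qed.

Lemma conj_funM g h p : conj_fun h (conj_fun g p) = conj_fun (h * g) p.
Proof. by apply/funext => x; rewrite /conj_fun; congr p; group_norm. Qed.

Lemma conj_fun1 p : conj_fun 1 p = p.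
Proof. by apply/funext => x; rewrite /conj_fun; congr p; group_norm. Qed.

Lemma conj_fun_cone g p : is_cone p -> is_cone (conj_fun g p).
Proof.
case=> _ p1 pM tot; split=> // [|x y px py|x _]; rewrite /conj_fun.
- by rewrite mulg1 mulVg.
- by have := pM _ _ px py; rewrite /is_true => <-; congr p; group_norm.
- have [e1|px|px] := tot (g^-1 * x * g) I; [apply: Or31|exact: Or32|apply: Or33].
    have -> : x = g * (g^-1 * x * g) * g^-1 by group_norm.
    by rewrite e1; group_norm.
  by move: px; rewrite /is_true => <-; congr p; group_norm.
Qed.

Lemma conj_fun_continuous g n : exists m, forall p q,
  agree m p q -> agree n (conj_fun g p) (conj_fun g q).
Proof.
elim: n => [|n [m mP]]; first by exists 0%N => p q _ i.
have [k kP] := agree_at (g^-1 * e n * g).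
exists (maxn m k) => p q a i; rewrite ltnS leq_eqVlt => /orP[/eqP->|lt].
  by apply: kP; apply: agree_leq a; exact: leq_maxr.
by apply: mP lt; apply: agree_leq a; exact: leq_maxl.
Qed.

Lemma agree_list (l : seq G) : exists n, forall p q, agree n p q ->
  forall x, x \in l -> p x = q x.
Proof.
elim: l => [|y l [n nP]]; first by exists 0%N.
have [k kP] := agree_at y; exists (maxn n k) => p q a x.
rewrite inE => /orP[/eqP->|xl].
  by apply: kP; apply: agree_leq a; exact: leq_maxr.
by apply: nP xl; apply: agree_leq a; exact: leq_maxl.
Qed.

Lemma closed_is_cone : closed_set is_cone.
Proof.
move=> p ap; have near (l : seq G) : exists2 q, is_cone q & forall x, x \in l -> p x = q x.
  by have [n nP] := agree_list l; have [q cq a] := ap n; exists q => //; exact: nP.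
split=> // [|x y|x _].
- by have [q [_ q1 _ _] qE] := near [:: 1]; rewrite qE ?inE.
- have [q [_ _ qM _] qE] := near [:: x; y; x * y].
  by rewrite !qE ?inE ?eqxx ?orbT //; exact: qM.
- have [q [_ _ _ /(_ x I) tot] qE] := near [:: x; x^-1].
  by rewrite !qE ?inE ?eqxx ?orbT.
Qed.

(* Greedily discarding, one pattern after the other, all orbits that meet it. *)
Fixpoint sieve (n : nat) p : Prop :=
  if n is n'.+1 then
    let s := odflt [::] (unpickle n') in
    sieve n' p /\ ((exists2 q, sieve n' q & forall g, ~ cylinder s (conj_fun g q)) ->
                   forall g, ~ cylinder s (conj_fun g p))
  else is_cone p.

Definition minimal_set p := forall n, sieve n p.

Lemma cylinder_agree s p q : agree (size s) p q -> cylinder s p -> cylinder s q.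
Proof. by move=> a c i lt; rewrite -a ?c. Qed.

Lemma sieve_closed n : closed_set (sieve n).
Proof.
elim: n => [|n IH]; first exact: closed_is_cone.
move=> p ap; split.
  by apply: IH => m; have [q [Kq _] a] := ap m; exists q.
move=> avoid g cg; set s := odflt _ _ in avoid cg.
have [m mP] := conj_fun_continuous g (size s).
have [q [_ /(_ avoid g) nc] a] := ap m.
by apply: nc; apply: cylinder_agree cg; apply: mP.
Qed.

Lemma sieve_conj n g p : sieve n p -> sieve n (conj_fun g p).
Proof.
elim: n p => [|n IH] p; first exact: conj_fun_cone.
case=> Kp av; split; first exact: IH.
by move=> /av nc h; rewrite conj_funM.
Qed.

Lemma minimal_closed : closed_set minimal_set.
Proof. by move=> p ap n; apply: sieve_closed => m; have [q Kq a] := ap m; exists q. Qed.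

Lemma minimal_conj g p : minimal_set p -> minimal_set (conj_fun g p).
Proof. by move=> Kp n; exact: sieve_conj. Qed.

Lemma minimal_ex : (exists p, is_cone p) -> exists p, minimal_set p.
Proof.
move=> ne; apply: compact_cylinders => [n|n|n p []//]; first exact: sieve_closed.
elim: n => [//|n [p Kp]].
case: (EM (exists2 q, sieve n q & forall g,
    ~ cylinder (odflt [::] (unpickle n)) (conj_fun g q))) => [[q Kq av]|no].
  by exists q; split.
by exists p; split=> // /no.
Qed.

(** If the orbit of p missed the pattern formed by the first n values of q, the stage of the sieve
    devoted to this pattern would have discarded q. This gives minimality without Zorn's lemma. *)
Lemma minimal_dense p q n : minimal_set p -> minimal_set q ->
  exists g, agree n (conj_fun g p) q.
Proof.
move=> Kp Kq; pose s := mkseq (fun i => q (e i)) n.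
have cE r : cylinder s r <-> agree n r q.
  by split=> c i lt; [rewrite c ?size_mkseq // nth_mkseq|
     move: lt; rewrite size_mkseq => lt; rewrite nth_mkseq // c].
suff [g /cE] : exists g, cylinder s (conj_fun g p) by exists g.
apply: contrapT => no; have [_] := Kq (pickle s).+1; rewrite pickleK [odflt _ _]/=.
move=> /(_ _ 1); apply; last by rewrite conj_fun1; apply/cE.
by exists p => [|g cg]; [exact: (Kp (pickle s))|apply: no; exists g].
Qed.

Variable E : nat -> G -> Prop.
Hypothesis E_all : forall P, cone (fun _ => True) P -> exists n, forall g, P g <-> E n g.

(* Otherwise the minimal set is perfect, and diagonalising against E inside it gives a cone
   that E misses. *)
Lemma minimal_isolated : (exists p, is_cone p) ->
  exists q n, minimal_set q /\ forall r, minimal_set r -> agree n q r -> r = q.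
Proof.
move=> /minimal_ex [p0 Kp0]; apply: contrapT => noiso.
have split_at p n : minimal_set p -> exists2 q, minimal_set q & agree n p q /\ q <> p.
  move=> Kp; apply: contrapT => no; apply: noiso; exists p, n; split=> // r Kr a.
  by apply: contrapT => ne; apply: no; exists r.
(* One diagonal stage: of two distinct points of the minimal set agreeing up to m, at least one
   differs from [E k] somewhere, and enough coordinates are then frozen to keep the difference. *)
have step (ks : nat * ((G -> bool) * nat)) : exists s : (G -> bool) * nat,
    minimal_set ks.2.1 -> [/\ minimal_set s.1, agree ks.2.2 ks.2.1 s.1, (ks.2.2 <= s.2)%N &
      forall r, agree s.2 s.1 r -> ~ forall g, r g <-> E ks.1 g].
  case: ks => k [p m] /=; case: (EM (minimal_set p)) => [Kp|nK]; last by exists (p, m).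
  have [q Kq [a qp]] := split_at p m Kp.
  have [p' [Kp' a' [x nx]]] : exists p',
      [/\ minimal_set p', agree m p p' & exists x, ~ (p' x <-> E k x)].
    apply: contrapT => no; apply: qp; apply/funext => x.
    have eqE p' : minimal_set p' -> agree m p p' -> p' x <-> E k x.
      by move=> Kp' ap'; apply: contrapT => nx; apply: no; exists p'; split=> //; exists x.
    by apply: is_true_inj; apply/propext; rewrite eqE // eqE.
  have [n nP] := agree_at x; exists (p', maxn m n); split=> //=; first exact: leq_maxl.
  move=> r ar rE; apply: nx; rewrite (nP p' r) //; apply: agree_leq ar; exact: leq_maxr.
have [st stP] := choice step.
pose s := fix s k := if k is k'.+1 then st (k', s k') else (p0, 0%N).
have Ks k : minimal_set (s k).1 by elim: k => //= k IH; have [] := stP (k, s k) IH.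
have [r rP] : exists r, forall k, minimal_set r /\ agree (s k).2 (s k).1 r.
  apply: compact_cylinders => [k p ap|k|k p [Kp a]].
  - split; first by apply: minimal_closed => m; have [q [Kq _] a] := ap m; exists q.
    have [q [_ a] a'] := ap (s k).2; exact: agree_trans a (agree_sym a').
  - by exists (s k).1.
  - split=> //; have [_ a1 le _] := stP (k, s k) (Ks k).
    by apply: agree_trans a1 _; exact: agree_leq le a.
have cr : is_cone r by have [Kr _] := rP 0%N; exact: (Kr 0%N).
have [k rE] := E_all cr.
have [_ _ _ no] := stP (k, s k) (Ks k).
by apply: (no r) rE; exact: (rP k.+1).2.
Qed.

(** Let r be an accumulation point of the translates of the isolated point q by the powers g^j. Some
    h moves r into the isolating neighbourhood of q, so h g^j fixes q for infinitely many j, and the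
    difference of two such j gives the exponent. *)
Lemma almost_invariant_cone : (exists P, cone (fun _ : G => True) P) ->
  exists2 P, cone (fun _ => True) P & forall g : G, exists2 n, (0 < n)%N &
    forall x, P ((g ^+ n)^-1 * x * g ^+ n) <-> P x.
Proof.
move=> [P cP]; have [|q [n [Kq iso]]] := minimal_isolated.
  by exists (fun x => `[<P x>]); case: cP => _ P1 PM tot; split=> // [/asboolP//|x y /asboolP ? /asboolP ?|x _];
    [apply/asboolP; exact: PM|case: (tot x I) => ?; [apply: Or31|apply: Or32; exact/asboolP|apply: Or33; exact/asboolP]].
exists (fun x => q x); first exact: (Kq 0%N).
move=> g.
have [r rP] : exists r, forall k m, exists2 j, (k <= j)%N & agree m r (conj_fun (g ^+ j) q).
  apply: compact_cylinders => [k p ap m|k|k p Cp m].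
  - have [r Cr a] := ap m; have [j kj a'] := Cr m; exists j => //; exact: agree_trans a a'.
  - by exists (conj_fun (g ^+ k) q) => m; exists k.
  - by have [j kj a] := Cp m; exists j => //; exact: ltnW.
have Kr : minimal_set r.
  apply: minimal_closed => m; have [j _ a] := rP 0%N m.
  by exists (conj_fun (g ^+ j) q) => //; exact: minimal_conj.
have [h ah] := minimal_dense n Kr Kq.
have [m mP] := conj_fun_continuous h n.
have hit k : exists2 j, (k <= j)%N & conj_fun h (conj_fun (g ^+ j) q) = q.
  have [j kj a] := rP k m; exists j => //; apply: iso.
    by do 2!apply: minimal_conj.
  by apply: agree_trans (agree_sym ah) _; exact: mP.
have [j1 _ h1] := hit 0%N; have [j2 lt h2] := hit j1.+1.
exists (j2 - j1)%N; first by lia.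
have e12 : conj_fun (g ^+ j2) q = conj_fun (g ^+ j1) q.
  have := congr1 (conj_fun h^-1) (etrans h2 (esym h1)).
  by rewrite !(conj_funM _ h^-1) !mulVg !conj_fun1.
have fixq : conj_fun (g ^+ (j2 - j1)) q = q.
  have := congr1 (conj_fun (g ^+ j1)^-1) e12; rewrite !conj_funM mulVg conj_fun1 => eq_q.
  by rewrite -[RHS]eq_q -[in RHS](subnKC (ltnW lt)) expgnDr mulKg.
by move=> x; rewrite -{2}fixq.
Qed.

End SpaceOfCones.

(** * Almost bi-invariant cones *)

Section Hoelder.
Variables (G : groupType) (N Q : G -> Prop).
Hypothesis nN : normal_in N (fun _ : G => True).
Hypothesis QN0 : forall x, N x -> ~ Q x.
Hypothesis QM : forall x y, Q x -> Q y -> Q (x * y).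
Hypothesis QJ : forall g x, Q x -> Q (g^-1 * x * g).
Hypothesis QNl : forall n x, N n -> Q x -> Q (n * x).
Hypothesis Qtot : forall x, [\/ N x, Q x | Q x^-1].
Hypothesis arch : forall x g, Q x -> exists j, Q (g^-1 * x ^+ j).

Let sN := normal_subgroup nN.
Let S x := Q x \/ N x.

Let NJ g x : N x -> N (g^-1 * x * g) := @normal_conj _ _ _ x g nN I.

Let QJV g x : Q x -> Q (g * x * g^-1).
Proof. by rewrite -{1}[g]invgK; exact: QJ. Qed.

Let SJ g x : S x -> S (g^-1 * x * g).
Proof. by case=> [Qx|Nx]; [left; exact: QJ|right; exact: NJ]. Qed.

Let QNr n x : N n -> Q x -> Q (x * n).
Proof.
move=> Nn Qx; have -> : x * n = x * (n * x) * x^-1 by group_norm.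
by apply: QJV; exact: QNl.
Qed.

Let SQ x y : S x -> Q y -> Q (x * y).
Proof. by case=> [Qx|Nx] Qy; [exact: QM|exact: QNl]. Qed.

Let QS x y : Q x -> S y -> Q (x * y).
Proof. by move=> Qx [Qy|Ny]; [exact: QM|exact: QNr]. Qed.

Let SM x y : S x -> S y -> S (x * y).
Proof.
move=> Sx [Qy|Ny]; first by left; exact: SQ.
by case: Sx => [Qx|Nx]; [left; exact: QNr|right; exact: subgroupM].
Qed.

Let nS x : ~ S x -> Q x^-1.
Proof. by case: (Qtot x) => // ? []; [right|left]. Qed.

Let Q1 : ~ Q 1. Proof. by apply: QN0; exact: subgroup1. Qed.

Lemma archimedean_floor d x : Q d ->
  exists k, S ((zexpg d k)^-1 * x) /\ Q (x^-1 * zexpg d (k + 1)%R).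
Proof.
move=> Qd; have [j Qj] := arch x Qd; have [i Qi] := arch x^-1 Qd; rewrite invgK in Qi.
have Qi' : Q (d ^+ i * x).
  by have := QJ x Qi; rewrite mulgA mulVg mul1g.
(* Since d^-i lies below x, shifting exponents by i turns the search for the floor into a
   minimisation over natural numbers. *)
pose p m := `[< Q (x^-1 * zexpg d (Posz m - Posz i)%R) >].
have ep : exists m, p m.
  by exists (i + j)%N; apply/asboolP; rewrite PoszD addrAC subrr add0r.
case: (ex_minnP ep) => -[|m] /asboolP Qm mmin.
  exfalso; apply: Q1; have := QM Qi' Qm.
  by rewrite sub0r zexpgN /= mulgA mulgK mulgV.
exists (Posz m - Posz i)%R; split; last first.
  by have -> : (Posz m - Posz i + 1 = Posz m.+1 - Posz i)%R by lia.
case: (EM (p m)) => [/mmin|npm]; first by rewrite ltnn.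
have npm' : ~ Q (x^-1 * zexpg d (Posz m - Posz i)%R) by move=> ?; apply: npm; exact/asboolP.
case: (Qtot (x^-1 * zexpg d (Posz m - Posz i)%R)) => // [Nm|Qm'].
  by right; have := subgroupV sN Nm; rewrite invgM invgK.
by left; move: Qm'; rewrite invgM invgK.
Qed.

(** If d^i <= x < d^(i+1) and d^j <= y < d^(j+1), then x y < d^(i+j+2) while y x >= d^(i+j), so the
    commutator (y x)^-1 (x y) is below d^2. *)
Lemma no_small_square d x y : Q d -> ~ S ((d * d)^-1 * (x^-1 * y^-1 * x * y)).
Proof.
move=> Qd Sb; have [i [Sx Qx]] := archimedean_floor x Qd.
have [j [Sy Qy]] := archimedean_floor y Qd.
set b := _ * _ in Sb; pose a := (zexpg d (j + i)%R)^-1 * (y * x).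
have Sa : S a.
  have -> : a = (zexpg d i)^-1 * ((zexpg d j)^-1 * y) * zexpg d i * ((zexpg d i)^-1 * x).
    by rewrite /a zexpgD; group_norm.
  by apply: SM => //; exact: SJ.
have Qq : Q ((x * y)^-1 * (zexpg d (j + i)%R * (d * d))).
  have -> : (x * y)^-1 * (zexpg d (j + i)%R * (d * d)) =
      (y^-1 * (x^-1 * zexpg d (i + 1)%R) * y) * (y^-1 * zexpg d (j + 1)%R).
    have -> : zexpg d (j + i)%R * (d * d) = zexpg d (i + 1)%R * zexpg d (j + 1)%R.
      by rewrite -zexpgD mulgA -!zexpg_succ; congr zexpg; lia.
    by group_norm.
  by apply: QM => //; exact: QJ.
apply: Q1; have := SQ Sb (QS Qq (SJ (d * d) Sa)).
by rewrite /a /b; group_norm.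
Qed.

(** Either every positive element is at least the square of a positive one, and no commutator can be
    positive; or some u lies below all positive squares, and it generates G/N. *)
Lemma hoelder_commutator x y : N (x^-1 * y^-1 * x * y).
Proof.
case: (EM (forall u, Q u -> exists2 d, Q d & S ((d * d)^-1 * u))) => [dense|].
  case: (Qtot (x^-1 * y^-1 * x * y)) => // [Qc|Qc].
    by have [d Qd] := dense _ Qc; move/(no_small_square Qd).
  have e : (x^-1 * y^-1 * x * y)^-1 = y^-1 * x^-1 * y * x by group_norm.
  by rewrite e in Qc; have [d Qd] := dense _ Qc; move/(no_small_square Qd).
move=> nd; have [u Qu umin] : exists2 u, Q u & forall d, Q d -> ~ S ((d * d)^-1 * u).
  apply: contrapT => no; apply: nd => u Qu; apply: contrapT => nod; apply: no.
  by exists u => // d Qd Sd; apply: nod; exists d.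
have cyc z : exists k, N ((zexpg u k)^-1 * z).
  have [k [[Qr|Nr] Qk]] := archimedean_floor z Qu; last by exists k.
  (* A remainder r strictly between 1 and u has u < r^2, hence (r^-1 u)^2 < u, against the choice of
     u. *)
  exfalso; set r := _ * z in Qr; have ru : Q (r^-1 * u).
    by move: Qk; rewrite zexpg_succ /r; group_norm.
  apply: (umin _ ru); left; have := nS (umin _ Qr) => /(QJV r) /(QJ u).
  by group_norm.
have [k Nk] := cyc x; have [l Nl] := cyc y.
have prod a b k' l' : N ((zexpg u k')^-1 * a) -> N ((zexpg u l')^-1 * b) ->
    N ((zexpg u (k' + l')%R)^-1 * (a * b)).
  move=> Na Nb; have := subgroupM sN (NJ (zexpg u l') Na) Nb.
  by rewrite zexpgD; group_norm.
have := subgroupM sN (subgroupV sN (prod _ _ _ _ Nl Nk)) (prod _ _ _ _ Nk Nl).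
by rewrite [(l + k)%R]addrC; group_norm.
Qed.

End Hoelder.

(** * From an almost bi-invariant cone to a quotient Z *)

Section AlmostInvariantCone.
Variables (G : groupType) (P : G -> Prop).
Hypothesis cP : cone (fun _ : G => True) P.
Hypothesis almost : forall g : G, exists2 n, (0 < n)%N &
  forall x, P ((g ^+ n)^-1 * x * g ^+ n) <-> P x.
Hypothesis fgG : fg_subgroup (fun _ : G => True).
Hypothesis ntG : exists g : G, g <> 1.
Implicit Types (x y z g : G).

Let le x y := x = y \/ P (x^-1 * y).
Let normz z := forall x, P (z^-1 * x * z) <-> P x.

Let PM x y : P x -> P y -> P (x * y). Proof. by case: cP => _ _ + _; apply. Qed.
Let P1 : ~ P 1. Proof. by case: cP. Qed.
Let PVF x : P x -> ~ P x^-1. Proof. exact: coneVF cP. Qed.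
Let Ptot x : [\/ x = 1, P x | P x^-1]. Proof. by case: cP => _ _ _; apply. Qed.

Let le_refl x : le x x. Proof. by left. Qed.
Let le_trans y x z : le x y -> le y z -> le x z.
Proof.
case=> [->//|Pxy] [<-|Pyz]; right=> //.
by have := PM Pxy Pyz; rewrite mulgA mulgK.
Qed.
Let le_mul2l g x y : le x y -> le (g * x) (g * y).
Proof. by case=> [->|Pxy]; [left|right; rewrite invgM mulgA mulgVK]. Qed.
Let le1 x : le 1 x <-> x = 1 \/ P x.
Proof. by rewrite /le invg1 mul1g; split=> -[->|?]; [left|right|left|right]. Qed.
Let lt_nle x y : P (x^-1 * y) <-> ~ le y x.
Proof.
split=> [Pxy [e|Pyx]|nle].
- by apply: P1; rewrite -(mulVg x) -{2}e.
- by apply: (PVF Pxy); rewrite invgM invgK.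
- case: (Ptot (x^-1 * y)) => // [e|Pyx].
    by case: nle; left; rewrite -[y](mulVKg x) e mulg1.
  by case: nle; right; rewrite invgM invgK in Pyx.
Qed.
Let le_total x y : le x y \/ le y x.
Proof. by case: (EM (le y x)) => [|/lt_nle ?]; [right|left; right]. Qed.
Let le_mul2r z x y : normz z -> le x y -> le (x * z) (y * z).
Proof.
move=> nz [->|Pxy]; [by left|right].
have -> : (x * z)^-1 * (y * z) = z^-1 * (x^-1 * y) * z by group_norm.
exact/nz.
Qed.
Let normzX z n : normz z -> normz (z ^+ n).
Proof.
move=> nz x; elim: n x => [|n IH] x; first by rewrite expg0; group_norm.
have -> : (z ^+ n.+1)^-1 * x * z ^+ n.+1 = (z ^+ n)^-1 * (z^-1 * x * z) * z ^+ n.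
  by rewrite expgS; group_norm.
by rewrite IH nz.
Qed.
Let normzV z : normz z -> normz z^-1.
Proof.
move=> nz x; rewrite -[P (_ * _)]nz.
by have -> : z^-1 * (z^-1^-1 * x * z^-1) * z = x by group_norm.
Qed.
Let le_inv x : le x^-1 1 <-> le 1 x.
Proof.
by split=> [/(le_mul2l x)|/(le_mul2l x^-1)]; rewrite ?mulgV ?mulVg mulg1.
Qed.
Let le1X z n : le 1 z -> le 1 (z ^+ n).
Proof.
move=> z1; elim: n => [|n IH]; first by left.
by rewrite expgS; apply: le_trans z1 _; have := le_mul2l z IH; rewrite mulg1.
Qed.
Let leX1 z n : le z 1 -> le (z ^+ n) 1.
Proof.
move=> z1; elim: n => [|n IH]; first by left.
by rewrite expgS; apply: (le_trans _ z1); have := le_mul2l z IH; rewrite mulg1.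
Qed.
Let leX z i j : le 1 z -> (i <= j)%N -> le (z ^+ i) (z ^+ j).
Proof.
move=> z1 ij; have := le_mul2l (z ^+ i) (le1X (j - i) z1).
by rewrite mulg1 -expgnDr subnKC.
Qed.

(** For z >= 1 normalising the cone, this is the convex subgroup generated by z. *)
Let B z g := exists j, le g (z ^+ j) /\ le g^-1 (z ^+ j).

Let sB z : normz z -> le 1 z -> is_subgroup (B z).
Proof.
move=> nz z1; split; first by exists 0%N; rewrite invg1; split; exact: le_refl.
have mul a b i j : le a (z ^+ i) -> le b (z ^+ j) -> le (a * b) (z ^+ (i + j)).
  move=> ai bj; apply: le_trans (le_mul2l a bj) _.
  by rewrite expgnDr; apply: le_mul2r => //; exact: normzX.
split=> [x y [i [xi xi']] [j [yj yj']]|x [i [xi xi']]]; last by exists i; rewrite invgK.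
by exists (i + j)%N; split; [exact: mul|rewrite invgM addnC; exact: mul].
Qed.

Let B_gen z x : le x z -> le x^-1 z -> B z x.
Proof. by exists 1%N. Qed.

Let normalising_power c : le 1 c -> exists2 n, (0 < n)%N &
  [/\ normz (c ^+ n), le 1 (c ^+ n) & le c (c ^+ n)].
Proof.
move=> c1; have [n n0 nP] := almost c; exists n => //; split=> //; first exact: le1X.
by rewrite -{1}[c]expg1; exact: leX.
Qed.

Let dominating (s : seq G) : exists2 c, le 1 c & forall x, x \in s -> le x c /\ le x^-1 c.
Proof.
elim: s => [|y s [c c1 cP']]; first by exists 1.
have mx a b : exists2 m, le a m & le b m.
  by case: (le_total a b) => ab; [exists b|exists a].
have [m1 ym ym'] := mx y y^-1; have [m m1m cm] := mx m1 c.
exists m => [|x]; first exact: le_trans c1 cm.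
rewrite inE => /orP[/eqP->|/cP'[xc xc']]; split; first exact: (le_trans _ m1m).
- exact: (le_trans _ m1m).
- exact: (le_trans _ cm).
- exact: (le_trans _ cm).
Qed.

(** Finite generation enters here: an upper bound of the generators and their inverses has a
    normalising power, and the powers of that are cofinal. *)
Let cofinal : exists z, [/\ normz z, P z & forall g, B z g].
Proof.
have [gens _ genP] := fgG; have [c c1 cg] := dominating gens.
have [n n0 [nz z1 cz]] := normalising_power c1; exists (c ^+ n).
have Bg g : B (c ^+ n) g.
  apply: (genP _ (sB nz z1)) => // x /cg[xc xc'].
  by apply: B_gen; exact: (le_trans _ cz).
split=> //; have /le1[e|//] := z1; exfalso; have [g gn1] := ntG.
have [j []] := Bg g; rewrite e expg1n => -[//|]; rewrite mulg1 => g1 [e'|].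
  by apply: gn1; rewrite -[g]invgK e' invg1.
by rewrite mulg1; exact: PVF.
Qed.

Lemma cyclic_quotient_of_almost_invariant :
  exists2 K, normal_in K (fun _ : G => True) &
    factor_infinite_cyclic (fun _ : G => True) K.
Proof.
have [z [nz Pz Bz]] := cofinal.
have z1 : le 1 z by apply/le1; right.
have le1_lt x : le x 1 -> P (x^-1 * z).
  move=> x1; apply/lt_nle => zx.
  have /lt_nle : P (1^-1 * z) by rewrite invg1 mul1g.
  by apply; exact: le_trans zx x1.
(* The elements negligible against z: all their powers, positive or negative, stay below z. This
   will be the kernel of the Archimedean quotient. *)
pose N g := forall k, P ((g ^+ k)^-1 * z) /\ P ((g^-1 ^+ k)^-1 * z).
have NV g : N g -> N g^-1 by move=> Ng k; rewrite invgK; have [] := Ng k.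
have N1 : N 1 by move=> k; rewrite invg1 expg1n invg1 mul1g.
have NX g n : N g -> N (g ^+ n).
  by move=> Ng k; rewrite -(expVgn g n) -!expgnA; exact: Ng.
have le_lt x y : le x y -> P (y^-1 * z) -> P (x^-1 * z).
  by move=> xy /lt_nle nzy; apply/lt_nle => zx; apply: nzy; exact: le_trans zx xy.
have N_B m g : N m -> le 1 m -> normz m -> B m g -> N g.
  move=> Nm m1 nm Bg k; have sBm := sB nm m1.
  have [j [gj _]] := subgroupX k sBm Bg.
  have [i [gi _]] := subgroupX k sBm (subgroupV sBm Bg).
  by split; [apply: le_lt gj _; case: (Nm j)|apply: le_lt gi _; case: (Nm i)].
have N_dom x y : N x -> le 1 x -> le y x -> le y^-1 x -> N y.
  move=> Nx x1 yx yx'; have [n n0 [nm m1 xm]] := normalising_power x1.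
  by apply: (N_B (x ^+ n)) => //; [exact: NX|apply: B_gen; exact: (le_trans _ xm)].
have N_convex x y : N x -> le 1 y -> le y x -> N y.
  move=> Nx y1 yx; have x1 := le_trans y1 yx; apply: (N_dom x) => //.
  by apply: (le_trans _ x1); exact/le_inv.
have Nabs x : N x -> exists2 a, N a & [/\ le 1 a, le x a & le x^-1 a].
  move=> Nx; have ge y : le 1 y -> [/\ le 1 y, le y y & le y^-1 y].
    by move=> y1; split=> //; apply: (le_trans _ y1); exact/le_inv.
  case: (le_total 1 x) => x1; first by exists x => //; exact: ge.
  exists x^-1; first exact: NV.
  have [|? ? ?] := ge x^-1; first by apply/le_inv; rewrite invgK.
  by split=> //; rewrite -[x in le x _]invgK.
have sN : is_subgroup N.
  split=> //; split=> // x y /Nabs [a Na [a1 xa xa']] /Nabs [b Nb [b1 yb yb']].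
  have [c Nc [c1 ac bc]] : exists2 c, N c & [/\ le 1 c, le a c & le b c].
    by case: (le_total a b) => ab; [exists b|exists a].
  have [n n0 [nm m1 cm]] := normalising_power c1.
  have am := le_trans ac cm; have bm := le_trans bc cm.
  apply: (N_B (c ^+ n)) => //; first exact: NX.
  by apply: (subgroupM (sB nm m1)); apply: B_gen; (exact: (le_trans _ am) || exact: (le_trans _ bm)).
pose Q x := P x /\ ~ N x.
have Pos_of_large x k : le z (x ^+ k) -> Q x.
  move=> zx; have nlt : ~ P ((x ^+ k)^-1 * z) by move/lt_nle.
  split; last by move=> /(_ k) [].
  by apply: contrapT => nPx; apply: nlt; apply: le1_lt; apply: leX1;
    case: (Ptot x) => [->|//|Px]; [left|right; rewrite mulg1].
(* Some power of x reaches z; a further power also normalises the cone, so it can take over the role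
   of z. *)
have large x : Q x -> exists r, [/\ normz (x ^+ r), le 1 (x ^+ r) & le z (x ^+ r)].
  move=> [Px nNx]; have x1 : le 1 x by apply/le1; right.
  have [k nk] : exists k, ~ P ((x ^+ k)^-1 * z).
    apply: contrapT => no; apply: nNx => k; split; first by apply: contrapT => ?; apply: no; exists k.
    by apply: le1_lt; apply: leX1; exact/le_inv.
  have zk : le z (x ^+ k) by apply: contrapT => /lt_nle.
  have [n n0 nP] := almost x; exists (n * k)%N; split.
  - by rewrite expgnA; apply: normzX => ?; exact: nP.
  - exact: le1X.
  - by apply: le_trans zk _; apply: leX => //; rewrite leq_pmull.
have largeB x r g : normz (x ^+ r) -> le 1 (x ^+ r) -> le z (x ^+ r) -> B (x ^+ r) g.
  move=> ny y1 zy; have sBy := sB ny y1.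
  have Bzy : B (x ^+ r) z.
    by apply: B_gen => //; apply: (le_trans _ y1); exact/le_inv.
  have [j [gj gj']] := Bz g; have [i [zi _]] := subgroupX j sBy Bzy.
  by exists i; split; apply: (le_trans _ zi).
have QJ g x : Q x -> Q (g^-1 * x * g).
  move=> Qx; have [r [ny y1 zy]] := large _ Qx; set y := x ^+ r in ny y1 zy.
  have [j [gj gj']] : B y g by exact: largeB.
  have low h : le h^-1 (y ^+ j) -> le (y ^+ j)^-1 h.
    move=> /(le_mul2l h); rewrite mulgV => /(le_mul2r (normzV (normzX j ny))).
    by rewrite mul1g mulgK.
  (* Conjugating by g costs at most y^j on each side, so the exponent 2j+1 still leaves one factor
     y, which is at least z. *)
  apply: (Pos_of_large _ (r * (j + j).+1)%N); apply: le_trans zy _.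
  have -> : (g^-1 * x * g) ^+ (r * (j + j).+1) = g^-1 * y ^+ (j + j).+1 * g.
    by rewrite -expgnA; have := conj_zexpg x g (r * (j + j).+1)%N => /= <-.
  have yj2 : y = (y ^+ j)^-1 * y ^+ j.+1 by rewrite expgSr mulKg.
  rewrite {1}yj2; apply: le_trans (le_mul2r (normzX j.+1 ny) (low g^-1 _)) _; first by rewrite invgK.
  rewrite -mulgA; apply: le_mul2l.
  have -> : y ^+ j.+1 = y ^+ (j + j).+1 * (y ^+ j)^-1 by rewrite -addSn expgnDr mulgK.
  by apply: le_mul2l; exact: low.
have Qdich x : ~ N x -> Q x \/ Q x^-1.
  move=> nNx; case: (Ptot x) => [e|Px|Px]; [by case: nNx; rewrite e|by left|right].
  by split=> // /NV; rewrite invgK.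
have nN : normal_in N (fun _ : G => True).
  split=> //; split=> // h n _ Nn; apply: contrapT => /Qdich.
  have back w : Q (h^-1 * w * h) -> Q w.
    by move=> /(QJ h^-1); congr Q; group_norm.
  case=> [/back[]//|]; rewrite (_ : _^-1 = h^-1 * n^-1 * h); last by group_norm.
  by move/back => [_]; apply; exact: NV.
have tfN x n : (0 < n)%N -> N (x ^+ n) -> N x.
  move=> n0 Nn; apply: contrapT => /Qdich.
  have pos y : N (y ^+ n) -> ~ Q y.
    move=> Nyn [Py]; apply; have y1 : le 1 y by apply/le1; right.
    by apply: (N_convex (y ^+ n)) => //; rewrite -{1}[y]expg1; exact: leX.
  by case=> [/pos|/pos]; apply=> //; rewrite expVgn; exact: NV.
have ab x y : N (x^-1 * y^-1 * x * y).
  apply: (@hoelder_commutator _ N Q) => //.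
  - by move=> w Nw [].
  - move=> v w [Pv nNv] [Pw nNw]; split; first exact: PM.
    move=> Nvw; apply: nNv; apply: (N_convex (v * w)) => //; first by apply/le1; right.
    have w1 : le 1 w by apply/le1; right.
    by have := le_mul2l v w1; rewrite mulg1.
  - move=> n w Nn [Pw nNw]; split; last by move/(subgroupMl _ sN Nn).
    case: (Ptot (n * w)) => // [e|].
      by case: nNw; apply/(subgroupMl _ sN Nn); rewrite e.
    rewrite invgM => Pw'; case: nNw; apply: (N_convex n^-1); [exact: NV|by apply/le1; right|].
    by right.
  - move=> w; case: (EM (N w)) => [|/Qdich[]]; by [apply: Or31|apply: Or32|apply: Or33].
  (* Aiming at g z instead of g leaves a margin z, which keeps the quotient outside [N]. *)
  - move=> w g Qw; have [r [ny y1 zy]] := large _ Qw.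
    have [j [gj _]] := largeB _ _ (g * z) ny y1 zy; exists (r * j)%N.
    apply: (Pos_of_large _ 1%N); rewrite expg1 expgnA.
    by have := le_mul2l g^-1 gj; rewrite mulKg.
apply: (cyclic_quotient_of_fg_abelian (subgroupT G) nN fgG) => //.
  by move=> x n _; exact: tfN.
by exists z => // /(_ 1%N) [/= +]; rewrite expg1 mulVg.
Qed.

End AlmostInvariantCone.

(** * Irrational slopes *)

Section IrrationalCut.
Implicit Types (a b c : rat) (x y : int).

Let lin x y c : rat := (x%:~R + y%:~R * c)%R.

Lemma lin_between x y a b c : (a <= c)%R -> (c <= b)%R ->
  (0 < lin x y a)%R -> (0 < lin x y b)%R -> (0 < lin x y c)%R.
Proof.
rewrite /lin => ac cb pa pb; case: (lerP 0%R (y%:~R : rat)%R) => y0.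
  by have := ler_wpM2l y0 ac; lra.
by have := ler_wnM2l (ltW y0) cb; lra.
Qed.

Lemma lin_opp x y c : lin (- x)%R (- y)%R c = (- lin x y c)%R.
Proof. by rewrite /lin !mulrNz mulNr opprD. Qed.

(** The limiting slope must be a root of no nonzero integer form. For y > 0 the form increases, so
    its sign at the midpoint selects a half; if it may vanish there, the left end is pushed beyond
    the midpoint. *)
Lemma avoid_root a b x y : (a < b)%R -> (x, y) != (0%R, 0%R) ->
  exists a' b', [/\ (a <= a')%R, (a' < b')%R, (b' <= b)%R &
    ((0 < lin x y a') && (0 < lin x y b') \/
     (0 < lin (- x) (- y) a') && (0 < lin (- x) (- y) b'))%R].
Proof.
move=> ab; rewrite xpair_eqE negb_and => xy0.
wlog y0 : x y xy0 / (0 <= y)%R => [wl|].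
  case: (lerP 0%R y) => y0; first exact: wl.
  have [||a' [b' [? ? ? s]]] := wl (- x)%R (- y)%R; rewrite ?oppr_eq0 ?oppr_ge0 ?ltW //.
  by exists a', b'; split=> //; move: s; rewrite !opprK => -[]; [right|left].
case: (eqVneq y 0%R) => [y00|yn0].
  have x0 : x != 0%R by move: xy0; rewrite y00 eqxx orbF.
  exists a, b; split=> //; rewrite !lin_opp /lin y00 !mul0r !addr0 oppr_gt0 !andbb.
  by rewrite ltr0z ltrz0; case: (ltgtP x 0%R) x0 => // _; [right|left].
have y1 : (0 < y%:~R :> rat)%R by rewrite ltr0z lt_def yn0.
pose m := ((a + b) / 2%:R)%R.
case: (lerP 0%R (lin x y m)) => s.
  exists ((m + b) / 2%:R)%R, b; split; [by rewrite /m; lra|by rewrite /m; lra|by []|left].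
  have d c : (m < c)%R -> (0 < lin x y c)%R.
    by move=> mc; apply: le_lt_trans s _; rewrite /lin ltrD2l ltr_pM2l.
  by rewrite !d //; rewrite /m; lra.
exists a, m; split; [by []|by rewrite /m; lra|by rewrite /m; lra|right].
rewrite !lin_opp !oppr_gt0 s andbT; apply: lt_trans s; rewrite /lin ltrD2l ltr_pM2l //.
by rewrite /m; lra.
Qed.

(** The form built from the numerator and denominator of the midpoint c vanishes at c, is negative
    to its left and positive to its right; the side contradicting [D] is kept. *)
Lemma dodge (D : int -> int -> Prop) a b : (a < b)%R ->
  exists a' b', [/\ (a <= a')%R, (a' < b')%R, (b' <= b)%R & exists x y,
    (D x y -> (0 < lin (- x) (- y) a') && (0 < lin (- x) (- y) b'))%R /\
    (~ D x y -> (0 < lin x y a') && (0 < lin x y b'))%R].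
Proof.
move=> ab; pose c := ((a + b) / 2%:R)%R; pose x := (- numq c)%R; pose y := denq c.
have y1 : (0 < y%:~R :> rat)%R by rewrite ltr0z denq_gt0.
have linE d : lin x y d = (y%:~R * (d - c))%R.
  by rewrite /lin /x mulrNz numqE -/y; ring.
case: (EM (D x y)) => Dxy.
  exists a, ((a + c) / 2%:R)%R; split; rewrite /c; try lra.
  exists x, y; split=> // _; rewrite !lin_opp !linE !oppr_gt0 !pmulr_rlt0 //.
  by apply/andP; split; rewrite /c; lra.
exists ((c + b) / 2%:R)%R, b; split; rewrite /c; try lra.
exists x, y; split=> // _; rewrite !linE !pmulr_rgt0 //.
by apply/andP; split; rewrite /c; lra.
Qed.

(* The positivity predicate of an irrational slope, located in a nested sequence of rational
   intervals chosen so as to differ from every D n. *)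
Lemma irrational_cut (D : nat -> int -> int -> Prop) :
  exists pos : int -> int -> Prop,
    [/\ ~ pos 0%R 0%R,
        forall x y x' y', pos x y -> pos x' y' -> pos (x + x')%R (y + y')%R,
        forall x y, (x, y) != (0%R, 0%R) -> pos x y \/ pos (- x)%R (- y)%R &
        forall n, exists x y, ~ (pos x y <-> D n x y)].
Proof.
pose sgn z (ab : rat * rat) := ((0 < lin z.1 z.2 ab.1) && (0 < lin z.1 z.2 ab.2))%R.
pose opp (z : int * int) := (- z.1, - z.2)%R.
have step (nab : nat * (rat * rat)) : exists ab' : rat * rat, (nab.2.1 < nab.2.2)%R ->
    [/\ (nab.2.1 <= ab'.1)%R, (ab'.1 < ab'.2)%R, (ab'.2 <= nab.2.2)%R &
      (forall z : int * int, unpickle nab.1 = Some z -> z != (0%R, 0%R) -> sgn z ab' \/ sgn (opp z) ab')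
      /\ exists z, (D nab.1 z.1 z.2 -> sgn (opp z) ab') /\ (~ D nab.1 z.1 z.2 -> sgn z ab')].
  case: nab => n [a b] /=; case: (EM (a < b)%R) => [ab|nab]; last by exists (a, b).
  (* Stage n first contradicts [D n], then settles the sign of the pair with code n; shrinking the
     interval preserves both. *)
  have [a1 [b1 [aa1 ab1 bb1 [x [y [d1 d2]]]]]] := dodge (D n) ab.
  have [a2 [b2 [aa2 ab2 bb2 root]]] : exists a2 b2, [/\ (a1 <= a2)%R, (a2 < b2)%R, (b2 <= b1)%R &
      forall z : int * int, unpickle n = Some z -> z != (0%R, 0%R) ->
        sgn z (a2, b2) \/ sgn (opp z) (a2, b2)].
    case: (unpickle n) => [[x' y']|]; last by exists a1, b1.
    case: (eqVneq (x', y') (0%R, 0%R)) => [z0|zn0].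
      by exists a1, b1; split=> // z [<-]; rewrite z0 eqxx.
    by have [a2 [b2 [? ? ? s]]] := avoid_root ab1 zn0; exists a2, b2; split=> // z [<-].
  exists (a2, b2) => _ /=; split; [exact: le_trans aa1 aa2|by []|exact: le_trans bb2 bb1|split=> //].
  have sub z : sgn z (a1, b1) -> sgn z (a2, b2).
    have a2b1 : (a2 <= b1)%R by apply: le_trans bb2; exact: ltW.
    have a1b2 : (a1 <= b2)%R by apply: le_trans aa2 _; exact: ltW.
    by case/andP => /= p1 p2; apply/andP; split; apply: (@lin_between _ _ a1 b1).
  by exists (x, y); split=> [/d1|/d2] s; apply: sub.
have [st stP] := choice step.
pose ab := fix ab n := if n is n'.+1 then st (n', ab n') else (0%R, 1%R).
have lt n : ((ab n).1 < (ab n).2)%R by elim: n => //= n IH; have [] := stP (n, ab n) IH.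
have mono m n : (m <= n)%N -> ((ab m).1 <= (ab n).1)%R /\ ((ab n).2 <= (ab m).2)%R.
  elim: n => [|n IH]; first by rewrite leqn0 => /eqP->.
  rewrite leq_eqVlt => /orP[/eqP->//|/IH[l r]].
  have [l' _ r' _] := stP (n, ab n) (lt n).
  by split; [exact: le_trans l l'|exact: le_trans r' r].
have smono z m n : (m <= n)%N -> sgn z (ab m) -> sgn z (ab n).
  move=> mn /andP[p1 p2]; have [l r] := mono m n mn; have lt' := ltW (lt n).
  apply/andP; split; apply: (lin_between _ _ p1 p2) => //.
    exact: le_trans lt' r.
  exact: le_trans l lt'.
have sgnF z n m : sgn z (ab n) -> sgn (opp z) (ab m) -> False.
  move=> /(smono _ _ _ (leq_maxl n m)) /andP[p _] /(smono _ _ _ (leq_maxr n m)) /andP[p' _].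
  by move: p'; rewrite lin_opp oppr_gt0 ltNge (ltW p).
exists (fun x y => exists n, sgn (x, y) (ab n)); split.
- by case=> n; rewrite /sgn /lin /= mul0r addr0 ltxx.
- move=> x y x' y' [n s] [m s']; exists (maxn n m).
  have /andP[p1 p2] := smono _ _ _ (leq_maxl n m) s.
  have /andP[p1' p2'] := smono _ _ _ (leq_maxr n m) s'.
  have linD d : lin (x + x')%R (y + y')%R d = (lin x y d + lin x' y' d)%R.
    by rewrite /lin !mulrzDr mulrDl addrACA.
  by apply/andP; split; rewrite linD; exact: addr_gt0.
- move=> x y z0; pose n := pickle (x, y).
  have [_ _ _ [dec _]] := stP (n, ab n) (lt n).
  by case: (dec (x, y)) => //; [rewrite pickleK|left; exists n.+1|right; exists n.+1].
- move=> n; have [_ _ _ [_ [[x y] [d1 d2]]]] := stP (n, ab n) (lt n).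
  exists x, y => -[pD Dp]; case: (EM (D n x y)) => Dxy.
    by have [m s] := Dp Dxy; apply: (sgnF (x, y) m n.+1) => //; exact: d1.
  by case: (Dxy); apply: pD; exists n.+1; exact: d2.
Qed.

End IrrationalCut.

(** * Groups all of whose left-orders are regular *)

(** The space of cones and Hölder's argument are set up for whole groups; a copy of the subgroup as
    a type makes them available for it. *)
Lemma subgroup_type (G : groupType) (H : G -> Prop) : is_subgroup H ->
  exists (T : groupType) (iota : T -> G),
    [/\ {morph iota : x y / x * y}, injective iota & forall g, H g <-> exists k, iota k = g].
Proof.
move=> sH; pose p : pred G := fun x => `[<H x>].
pose T0 := {x : G | p x}.
have HT (x : T0) : H (val x) by apply/asboolP; exact: (valP x).
pose mk x (Hx : H x) : T0 := Sub x (asboolT Hx).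
pose one := mk 1 (subgroup1 sH).
pose mul (x y : T0) := mk _ (subgroupM sH (HT x) (HT y)).
pose inv (x : T0) := mk _ (subgroupV sH (HT x)).
have mulA : associative mul by move=> x y z; apply: val_inj; exact: mulgA.
have mul1 : left_id one mul by move=> x; apply: val_inj; exact: mul1g.
have mulr1 : right_id one mul by move=> x; apply: val_inj; exact: mulg1.
have mulV : left_inverse one inv mul by move=> x; apply: val_inj; exact: mulVg.
have mulrV : right_inverse one inv mul by move=> x; apply: val_inj; exact: mulgV.
pose T : groupType := HB.pack T0 (isGroup.Build T0 mulA mul1 mulr1 mulV mulrV).
exists T, (fun x : T => val (x : T0)); split=> [//|x y|g]; first exact: val_inj.
by split=> [Hg|[k <-]]; [exists (mk g Hg)|exact: HT].
Qed.

(** * Transport along an injective homomorphism *)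

Section Indicability.
Variables (G T : groupType) (iota : T -> G).
Hypotheses (iM : {morph iota : x y / x * y}) (iI : injective iota).

Let i1 : iota 1 = 1.
Proof. by apply: (@mulgI _ (iota 1)); rewrite -iM !mulg1. Qed.
Let iV x : iota x^-1 = (iota x)^-1.
Proof. by apply: (@mulgI _ (iota x)); rewrite -iM !mulgV i1. Qed.

Definition image_pred (K : T -> Prop) g := exists2 k, K k & iota k = g.

Lemma image_subgroup K : is_subgroup K -> is_subgroup (image_pred K).
Proof.
move=> sK; split; first by exists 1; rewrite // ; exact: subgroup1.
split=> [x y [a Ka <-] [b Kb <-]|x [a Ka <-]].
  by exists (a * b); [exact: subgroupM|exact: iM].
by exists a^-1; [exact: subgroupV|exact: iV].
Qed.

Lemma image_predE K x : image_pred K (iota x) <-> K x.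
Proof. by split=> [[k Kk /iI <-]|Kx] //; exists x. Qed.

Lemma iota_zexpg x k : iota (zexpg x k) = zexpg (iota x) k.
Proof.
have iX n : iota (x ^+ n) = iota x ^+ n.
  by elim: n => [|n IH]; rewrite ?i1 // !expgS iM IH.
by case: k => n; rewrite /= ?iV iX.
Qed.

Lemma image_cone P : cone (fun _ : T => True) P ->
  cone (image_pred (fun _ => True)) (image_pred P).
Proof.
case=> _ P1 PM tot; split.
- by move=> x [k _ <-]; exists k.
- by rewrite -i1 => /image_predE.
- by move=> x y [a Pa <-] [b Pb <-]; exists (a * b); [exact: PM|exact: iM].
- move=> x [k _ <-]; case: (tot k I) => [->|Pk|Pk]; first exact: Or31.
    by apply: Or32; exists k.
  by apply: Or33; exists k^-1.
Qed.

Lemma preimage_cone P : cone (image_pred (fun _ => True)) P ->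
  cone (fun _ : T => True) (fun x => P (iota x)).
Proof.
case=> _ P1 PM tot; split=> //; first by rewrite i1.
  by move=> x y Px Py; rewrite iM; exact: PM.
move=> x _; case: (tot (iota x)) => [|e|Px|Px]; first by exists x.
- by apply: Or31; apply: iI; rewrite e i1.
- exact: Or32.
- by apply: Or33; rewrite iV.
Qed.

Lemma image_cyclic_quotient K : normal_in K (fun _ => True) ->
  factor_infinite_cyclic (fun _ => True) K ->
  normal_in (image_pred K) (image_pred (fun _ => True)) /\
  factor_infinite_cyclic (image_pred (fun _ => True)) (image_pred K).
Proof.
move=> nK [t [_ [ex uniq]]]; split.
  split; first by apply: image_subgroup; exact: normal_subgroup nK.
  split=> [x [k _ <-]|h n [a _ <-] [b Kb <-]]; first by exists k.
  exists (a^-1 * b * a); first exact: (normal_conj nK).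
  by rewrite !iM iV.
exists (iota t); split; first by exists t.
split=> [h [a _ <-]|k].
  have [k Kk] := ex a I; exists k; exists ((zexpg t k)^-1 * a) => //.
  by rewrite iM iV iota_zexpg.
by rewrite -iota_zexpg => /image_predE; exact: uniq.
Qed.

Lemma fg_of_image : fg_subgroup (image_pred (fun _ => True)) ->
  fg_subgroup (fun _ : T => True).
Proof.
case=> gens gH genP.
have pre g : exists k, image_pred (fun _ => True) g -> iota k = g.
  by case: (EM (image_pred (fun _ => True) g)) => [[k _ <-]|]; [exists k|exists 1].
have [s sP] := choice pre; exists (map s gens) => // K sK Ks h _.
apply/image_predE; apply: (genP _ (image_subgroup sK)); last by exists h.
move=> x xg; exists (s x); last by apply: sP; exact: gH.
by apply: Ks; exact: map_f.
Qed.

End Indicability.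

(** Regularity acts twice: countably many cones produce an almost invariant one, and finite
    generation lets that cone yield a quotient Z. *)
Lemma all_cones_regular_indicable (G : groupType) (H : G -> Prop) :
  all_cones_regular H -> (exists2 x, H x & x <> 1) ->
  exists2 K, normal_in K H & factor_infinite_cyclic H K.
Proof.
move=> aH [x0 Hx0 x01]; have fgH := all_cones_regular_fg aH; have [sH [P0 cP0] reg] := aH.
have [T [iota [iM iI imH]]] := subgroup_type sH.
have HE : H = image_pred iota (fun _ => True).
  by apply/funext => g; apply/propext; rewrite imH; split=> [[k]|[k _]]; exists k.
have [e eP] := fg_countable fgH; have [E EP] := regular_cones_countable eP.
have pre n : exists k, H (e n) -> iota k = e n.
  by case: (EM (H (e n))) => [/imH[k kE]|]; [exists k|exists 1].
have [e' e'P] := choice pre.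
have e'_surj k : exists n, e' n = k.
  have Hk : H (iota k) by apply/imH; exists k.
  have [n nE] := eP _ Hk; exists n; apply: iI; rewrite e'P ?nE //.
rewrite HE in cP0 fgH reg EP *.
have fgT := fg_of_image iM iI fgH.
have allE P : cone (fun _ : T => True) P -> exists n, forall g, P g <-> E n (iota g).
  move=> /(image_cone iM iI) /reg /EP [n nE]; exists n => g.
  by rewrite -nE; split=> /(image_predE iI).
have [|P cP almost] := almost_invariant_cone e'_surj (E := fun n g => E n (iota g)) allE.
  by exists (fun x => P0 (iota x)); exact: preimage_cone.
have [|K nK cK] := cyclic_quotient_of_almost_invariant cP almost fgT.
  have [k kE] := (imH x0).1 Hx0; exists k => k1; apply: x01.
  have i1 : iota 1 = 1 by apply: (@mulgI _ (iota 1)); rewrite -iM !mulg1.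
  by rewrite -kE k1 i1.
by have [] := image_cyclic_quotient iM iI nK cK; exists (image_pred iota K).
Qed.

(** * Diagonal arguments on chains of subgroups, and the resulting series *)

Section ManyCones.
Variable G : groupType.

(** An element is judged by its degree at the last term containing it, with a sign that is free at
    every level; elements of all terms are left to [P0]. *)
Lemma no_infinite_series (S : nat -> G -> Prop) :
  all_cones_regular (S 0%N) -> (forall i, normal_in (S i.+1) (S i)) ->
  (forall i, exists psi, degree (S i) (S i.+1) psi) -> False.
Proof.
move=> aS nS /choice [psi dpsi]; have [sS0 [P0 [P0S P01 P0M P0tot]] reg] := aS.
have [e eP] := fg_countable (all_cones_regular_fg aS).
have [E EP] := regular_cones_countable eP.
have sS i : is_subgroup (S i) by case: i => // i; exact: normal_subgroup (nS i).
have sub i j x : (i <= j)%N -> S j x -> S i x.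
  elim: j => [|j IH]; first by rewrite leqn0 => /eqP->.
  by rewrite leq_eqVlt => /orP[/eqP->//|ij] /(normal_sub (nS j)); exact: IH.
have gen i : exists t, S i t /\ psi i t = 1%R.
  by have [_ _ [t St t1]] := dpsi i; exists t.
have [t tP] := choice gen.
(* The diagonal choice: t_i becomes positive exactly when [E i] excludes it. *)
pose s i : int := if `[< E i (t i) >] then (-1)%R else 1%R.
have s2 i : s i = 1%R \/ s i = (-1)%R by rewrite /s; case: asboolP; [right|left].
pose Sw x := forall i, S i x.
pose P x := (exists2 i, S i x & (0 < s i * psi i x)%R) \/ (Sw x /\ P0 x).
have psi0 i x : S i.+1 x -> psi i x = 0%R.
  by move=> Sx; have [_ kp _] := dpsi i; apply/kp => //; exact: normal_sub Sx.
have psiM i : hom_on (S i) (psi i) by case: (dpsi i).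
have cP : cone (S 0%N) P.
  split.
  - by move=> x [[i Sx _]|[Sx _]] //; apply: sub Sx.
  - by case=> [[i _]|[_ //]]; rewrite (hom1 (sS i) (psiM i)) mulr0 ltxx.
  - move=> x y [[i Sx px]|[Sx px]] [[j Sy py]|[Sy py]].
    + left; case: (ltngtP i j) => ij.
      * have Sy' := sub _ _ _ ij Sy; exists i; first by apply: subgroupM => //; exact: sub Sy'.
        by rewrite psiM ?(psi0 i y) ?addr0 //; exact: sub Sy'.
      * have Sx' := sub _ _ _ ij Sx; exists j; first by apply: subgroupM => //; exact: sub Sx'.
        by rewrite psiM ?(psi0 j x) ?add0r //; exact: sub Sx'.
      * subst j; exists i; first exact: subgroupM.
        by rewrite psiM // mulrDr addr_gt0.
    + by left; exists i; [exact: subgroupM|rewrite psiM // (psi0 i y) // addr0].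
    + by left; exists j; [exact: subgroupM|rewrite psiM // (psi0 j x) // add0r].
    + by right; split; [move=> i; exact: subgroupM|exact: P0M].
  - move=> x Sx; case: (EM (Sw x)) => [Swx|nSw].
      case: (P0tot x Sx) => [->|Px|Px]; [exact: Or31|by apply: Or32; right|].
      by apply: Or33; right; split=> // i; exact: subgroupV.
    have [i Si nSi] : exists2 i, S i x & ~ S i.+1 x.
      apply: contrapT => no; apply: nSw; elim=> // i Si; apply: contrapT => nSi.
      by apply: no; exists i.
    have pn : psi i x != 0%R.
      by apply/eqP => p0; apply: nSi; have [_ kp _] := dpsi i; exact/kp.
    have sp : (s i * psi i x != 0)%R by case: (s2 i) => ->; rewrite ?mul1r ?mulN1r ?oppr_eq0.
    case: (ltgtP 0%R (s i * psi i x)%R) sp => // sp _.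
      by apply: Or32; left; exists i.
    apply: Or33; left; exists i; first exact: subgroupV.
    by rewrite (homV (sS i) (psiM i)) // mulrN oppr_gt0.
have [n nE] := EP _ (reg _ cP); have [St t1] := tP n.
have := nE (t n); case: (EM (E n (t n))) => En; last first.
  case=> + _; move=> PE; apply/En/PE; left; exists n => //.
  by rewrite t1 mulr1 /s; case: asboolP.
move=> [_ /(_ En)] Pt; have Pt' : P (t n)^-1.
  left; exists n; first exact: subgroupV.
  by rewrite (homV (sS n) (psiM n)) // t1 /s; case: asboolP.
exact: coneVF cP Pt Pt'.
Qed.

(* A bi-orderable quotient with two infinite cyclic factors is Z^2, which has uncountably many
   orders, one for each irrational slope. *)
Lemma not_biorderable_of_regular (H M N : G -> Prop) phi psi :
  all_cones_regular H -> normal_in M H -> normal_in N M ->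
  degree H M phi -> degree M N psi -> ~ quotient_biorderable H N.
Proof.
move=> aH nM nN dphi dpsi bi; have [sH [P0 [P0H P01 P0M P0tot]] reg] := aH.
have sM := normal_subgroup nM; have sN := normal_subgroup nN.
have [nNH pres] := preserving_of_biorderable sH nM nN dpsi bi.
have [hphi kphi [t Ht t1]] := dphi; have [hpsi kpsi [u Mu u1]] := dpsi.
have MH x : M x -> H x by exact: (normal_sub nM).
have NM x : N x -> M x by exact: (normal_sub nN).
have Hz k : H (zexpg t k) by exact: subgroup_zexpg.
(* Second coordinate on H/N: the degree left after removing t^(phi h). It is additive because
   conjugation by t preserves [psi]. *)
pose r h := (zexpg t (phi h))^-1 * h; pose b h := psi (r h).
have phiz k : phi (zexpg t k) = k by rewrite (hom_zexpg sH hphi) // t1 intz.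
have Mr h : H h -> M (r h).
  move=> Hh; apply/kphi; first by apply: subgroupM => //; exact: subgroupV.
  by rewrite hphi ?(homV sH hphi) ?phiz ?addNr //; exact: subgroupV.
have hb : hom_on H b.
  move=> x y Hx Hy; rewrite /b.
  have -> : r (x * y) = ((zexpg t (phi y))^-1 * r x * zexpg t (phi y)) * r y.
    by rewrite /r hphi // zexpgD; group_norm.
  have Mx := Mr _ Hx; have My := Mr _ Hy.
  by rewrite hpsi ?pres //; exact: (normal_conj nM).
have kN h : H h -> (N h <-> (phi h, b h) = (0%R, 0%R)).
  move=> Hh; split=> [Nh|[p0]].
    have p0 : phi h = 0%R by apply/kphi; auto.
    by rewrite /b /r p0 /= invg1 mul1g; congr pair; apply/kpsi; auto.
  by rewrite /b /r p0 /= invg1 mul1g => ?; apply/kpsi => //; exact/kphi.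
pose w x y := zexpg t x * zexpg u y.
have Muz y : M (zexpg u y) by exact: subgroup_zexpg.
have Hw x y : H (w x y) by apply: subgroupM => //; auto.
have phiw x y : phi (w x y) = x.
  by rewrite hphi ?phiz //; [rewrite ((kphi _ _).1 (Muz y)) ?addr0|]; auto.
have bw x y : b (w x y) = y.
  by rewrite /b /r phiw /w mulKg (hom_zexpg sM hpsi) // u1 intz.
have [e eP] := fg_countable (all_cones_regular_fg aH).
have [E EP] := regular_cones_countable eP.
(* The relations to be avoided are the enumerated cones read on the representatives [w x y] of
   Z^2. *)
have [pos [pos0 posD postot posE]] := irrational_cut (fun n x y => E n (w x y)).
pose P h := H h /\ (pos (phi h) (b h) \/ N h /\ P0 h).
have cP : cone H P.
  split.
  - by move=> x [].
  - by case=> _; rewrite (hom1 sH hphi) (hom1 sH hb) => -[//|[]].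
  - move=> x y [Hx px] [Hy py]; split; first exact: subgroupM.
    rewrite hphi // hb //; case: px py => [px|[Nx px]] [py|[Ny py]].
    + by left; exact: posD.
    + by left; have [-> ->] := (kN _ Hy).1 Ny; rewrite !addr0.
    + by left; have [-> ->] := (kN _ Hx).1 Nx; rewrite !add0r.
    + by right; split; [exact: subgroupM|exact: P0M].
  - move=> x Hx; have HV := subgroupV sH Hx; case: (EM (N x)) => Nx.
      case: (P0tot x Hx) => [->|Px|Px]; [exact: Or31|by apply: Or32; split=> //; right|].
      by apply: Or33; split=> //; right; split=> //; exact: subgroupV.
    have /postot [p|p] : (phi x, b x) != (0%R, 0%R) by apply/eqP => /(kN _ Hx).
      by apply: Or32; split=> //; left.
    by apply: Or33; split=> //; left; rewrite (homV sH hphi) // (homV sH hb).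
have [n nE] := EP _ (reg _ cP); have [x [y]] := posE n; apply.
rewrite -nE; split=> [p|[_]]; first by split=> //; left; rewrite phiw bw.
rewrite phiw bw => -[//|[/(kN _ (Hw _ _))]]; rewrite phiw bw => -[-> ->].
by rewrite /w /= mulg1.
Qed.

Lemma poly_Z_tararin_degree m (S : nat -> G -> Prop) :
  poly_Z G -> tararin_series m S ->
  forall i, (i < m)%N -> exists psi, degree (S i) (S i.+1) psi.
Proof.
move=> pz [ser [rk _]] i lt; have sS := series_subgroup ser (ltnW lt).
have nS := series_normal ser lt; apply: cyclic_degree => //.
by apply: cyclic_of_rank1 => //; [exact: poly_Z_fg_subgroup|exact: rk].
Qed.

(** Kernels of quotients Z are iterated through a total choice function, meaningful only at
    nontrivial terms; the chain is cut at its first trivial term, which exists because no infinite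
    chain does. *)
Lemma all_cones_regular_series : all_cones_regular (fun _ : G => True) ->
  exists n (S : nat -> G -> Prop), [/\ subnormal_series n S,
    forall i, (i < n)%N -> exists psi, degree (S i) (S i.+1) psi &
    forall i, (i <= n)%N -> all_cones_regular (S i)].
Proof.
move=> aG.
have next (H : G -> Prop) : exists K, all_cones_regular H -> (exists2 x, H x & x <> 1) ->
    [/\ all_cones_regular K, normal_in K H & exists psi, degree H K psi].
  case: (EM (all_cones_regular H /\ exists2 x, H x & x <> 1)) => [[aH nt]|no]; last first.
    by exists H => aH nt; case: no.
  have [K nK cK] := all_cones_regular_indicable aH nt; exists K => _ _.
  have [sH _ _] := aH; have [psi dpsi] := cyclic_degree sH nK cK.
  by split=> //; [exact: all_cones_regular_kernel dpsi aH|exists psi].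
have [nx nxP] := choice next; pose S := fix S n := if n is n'.+1 then nx (S n') else fun _ => True.
pose triv n := `[< ~ exists2 x, S n x & x <> 1 >].
have trivP n : ~~ triv n -> exists2 x, S n x & x <> 1.
  by move/asboolP => nn; exact: contrapT.
have [ex|no] := EM (exists n, triv n); last first.
  have nt n : exists2 x, S n x & x <> 1 by apply: trivP; apply/negP => ?; apply: no; exists n.
  have aS n : all_cones_regular (S n) by elim: n => //= n IH; have [] := nxP _ IH (nt n).
  have ok n := nxP _ (aS n) (nt n).
  by exfalso; apply: (@no_infinite_series S) => // i; have [] := ok i.
case: (ex_minnP ex) => n /asboolP tn nmin; exists n, S.
have nt i : (i < n)%N -> exists2 x, S i x & x <> 1.
  by move=> lt; apply: trivP; apply/negP => /nmin; rewrite leqNgt lt.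
have aS i : (i <= n)%N -> all_cones_regular (S i).
  by elim: i => //= i IH lt; have [] := nxP _ (IH (ltnW lt)) (nt i lt).
have ok i (lt : (i < n)%N) := nxP _ (aS i (ltnW lt)) (nt i lt).
split=> // [|i lt]; last by have [] := ok i lt.
split=> //; split=> [x|i lt]; last by have [] := ok i lt.
split=> [Sx|->]; first by apply: contrapT => x1; apply: tn; exists x.
by have [sS _ _] := aS n (leqnn n); exact: subgroup1.
Qed.

End ManyCones.

Theorem theorem4p9 (G : groupType) :
  finitely_generated G -> left_orderable G ->
  ((forall lt : G -> G -> Prop, left_order lt -> regular_left_order lt) <->
   (tararin_group G /\ poly_Z G)).
Proof.
move=> _ [lt0 lo0]; split=> [allreg|[[n [S [tS _]]] pz] lt]; last first.
  by apply: (tararin_regular tS); exact: poly_Z_tararin_degree.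
have aG : all_cones_regular (fun _ : G => True).
  split; [exact: subgroupT|by exists (positive_cone lt0); exact: left_order_cone|].
  move=> P cP; have [X [f [_ [Q [q0 [delta [F PE]]]]]]] := allreg _ (cone_left_order cP).
  exists X, f; split=> //; exists Q, q0, delta, F => g; rewrite -PE /positive_cone.
  by rewrite invg1 mul1g.
have [n [S [ser deg aS]]] := all_cones_regular_series aG.
have sS i (lt : (i < n)%N) := series_subgroup ser (ltnW lt).
have pz : poly_Z G.
  exists n, S; split=> // i lt; have [psi dpsi] := deg i lt.
  exact: degree_cyclic (sS i lt) dpsi.
have tS : tararin_series n S.
  split=> //; split=> i lt.
    have [psi dpsi] := deg i lt.
    exact: rank1_of_degree (sS i lt) (series_normal ser lt) dpsi.
  have [phi dphi] := deg i (ltnW lt); have [psi dpsi] := deg i.+1 lt.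
  exact: not_biorderable_of_regular (aS i (ltnW (ltnW lt))) (series_normal ser (ltnW lt))
    (series_normal ser lt) dphi dpsi.
split=> //; exists n, S; split=> // m S' tS'.
exact: tararin_series_unique tS deg tS' (poly_Z_tararin_degree pz tS').
Qed.
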